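(* Let $p$ be a prime, $n\ge1$, $G=\langle\sigma\rangle\simeq\mathbb{Z}/p^n\mathbb{Z}$, and suppose $K/F$ is a Galois extension with $\mathrm{Gal}(K/F)=\langle\sigma\rangle$ such that $K$ contains a primitive $p$-th root of unity. Let $A\simeq\bigoplus_{i=1}^{p^n}\bigoplus_{d_i}\mathbb{F}_p[G]/(\sigma-1)^i$ be a finite $\mathbb{F}_p[G]$-module and define $\lceil A\rceil=\bigoplus_{i=1}^{p^n}\bigoplus_{d_i}\mathbb{F}_p[G]/(\sigma-1)^{p^{\lceil\log_p i\rceil}}$. If $F\in\mathfrak{F}(A\rtimes G)$, then $F\in\mathfrak{F}(\lceil A\rceil\rtimes G)$.
   Context: For a finite group $H$, $\mathfrak{F}(H)$ is the class of fields $F$ admitting a Galois extension $L/F$ with $\mathrm{Gal}(L/F)\simeq H$. Semidirect products are formed with respect to the given $G$-action on the module. *)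

(* Defs.v *)
From HB Require Import structures.
From mathcomp Require Import all_boot all_order all_algebra all_fingroup.
From mathcomp Require Import all_solvable all_field all_character.

Set Implicit Arguments.
Unset Strict Implicit.
Unset Printing Implicit Defensive.

Import GRing.Theory.
Local Open Scope ring_scope.

(* F \in \mathfrak{F}(H). The base field F sits in L as the subfield 1. *)
Definition realizes (F : fieldType) (gT : finGroupType) (H : {group gT}) :
    Prop :=
  exists L : splittingFieldType F,
    galois 1 {:L} /\ 'Gal({:L} / 1) \isog H.

(* A finite F_p[G]-module is a matrix representation of G on 'rV['F_p]_m;     *)
(* 'MR rG is the associated action of G on the additive group 'rV['F_p]_m.    *)
Definition modsdprod (p : nat) (gT : finGroupType) (G : {group gT}) (m : nat)
    (rG : mx_representation 'F_p G m) :
    {group sdprod_by ('MR rG)%gact} :=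
  [set: sdprod_by ('MR rG)%gact]%G.

Section CyclicModules.

Variables (p : nat) (gT : finGroupType) (s : gT).

Local Notation aG := (regular_repr 'F_p <[s]>%g).

(* Coordinates of (s - 1) ^+ i \in F_p[<[s]>] in the basis <[s]>: aG embeds   *)
(* the group ring in a matrix ring and gring_row reads off the coordinates.   *)
Definition aug_pow (i : nat) : 'rV['F_p]_#|<[s]>%g| :=
  gring_row ((aG s - 1%:M) ^+ i).

(* F_p[<[s]>] / ((s - 1) ^+ i) *)
Definition cyc_mod (i : nat) : representation 'F_p <[s]>%G :=
  Representation (factmod_repr (cyclic_mx_module aG (aug_pow i))).

(* \bigoplus_(1 <= i <= N) \bigoplus_(d i) F_p[<[s]>] / ((s - 1) ^+ (e i)) *)
Definition cyc_sum (N : nat) (d e : nat -> nat) : representation 'F_p <[s]>%G :=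
  \big[dadd_grepr/grepr0]_(1 <= i < N.+1) muln_grepr (cyc_mod (e i)) (d i).

(* up_log p i is the ceiling of log_p i. *)
Definition ceil_mod (N : nat) (d : nat -> nat) : representation 'F_p <[s]>%G :=
  cyc_sum N d (fun i => (p ^ up_log p i)%N).

End CyclicModules.

(* Main.v *)
(* Since [K : F] is prime to p - 1, F contains the p-th roots of unity. Let    *)
(* K1 / F be the cyclic subextension, with group <s>, cut out by A in an       *)
(* A ><| G-extension. By Kummer theory that extension is generated by p-th     *)
(* roots of a finite G-submodule M of J = K1^* / K1^*p dual to A; conversely a *)
(* submodule gives a split extension iff every generator c of a block of       *)
(* length < p^n has norm N(c) in F^*p. So each generator c of a block of       *)
(* length i, with p^(k-1) < i <= p^k, has to be replaced by some c' of length  *)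
(* p^k with the same socle, i.e. (s-1)^(p^k-1) c' = (s-1)^(i-1) c in J, still  *)
(* satisfying the norm condition; independence of the socles then keeps the    *)
(* sum of the blocks direct.                                                   *)
(*   The norm condition and Hilbert 90 show that the socle is the class of     *)
(* some f in F^*, and that some power (s-1)^j c is represented in the subfield *)
(* K_k of degree p^k over F, with image f under s^(p^(k-1)) - 1. Comparing     *)
(* p-th roots of norms, f is a norm N(y) from K_k to K_(k-1). As f lies in F,  *)
(* (s-1) y has norm 1, hence equals (s^(p^(k-1)) - 1) w with w in K_k, and     *)
(* then (s-1)^(p^k-1) w = f in J.                                              *)
Require Import Defs.
From HB Require Import structures.
From mathcomp Require Import all_boot all_order all_algebra all_fingroup.
From mathcomp Require Import all_solvable all_field all_character.
From mathcomp Require Import ring zify.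
From Stdlib Require Import Classical.

Set Implicit Arguments.
Unset Strict Implicit.
Unset Printing Implicit Defensive.

Import GRing.Theory.
Local Open Scope ring_scope.

(** * Power classes and cyclic norms *)

(** The Galois theory is condensed into [radical_data s l b]: over a cyclic extension of F with
    group generated by s, one string of elements [b j g] per block length in [l], such that s - 1
    moves down each string modulo p-th powers, the strings are independent modulo p-th powers, and
    each top satisfies a norm condition. The module is seen only through [jcoord], Jordan
    coordinates with the same list of block lengths. [kummer_radical_data] extracts such strings
    from a split extension, and [radical_realizes] builds a split extension from them. The theorem
    thus reduces to [radical_lift]: over the same cyclic extension, strings of lengths [l] yield
    strings of lengths [map ceil l].

    The heart is [length_lift], which prolongs one string to length p^k without changing its socle
    class. This is enough for independence, because powers of s - 1 push any relation into the
    socles. The norm condition comes for free: for k < n the new top lies in the subfield of degree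
    p^k, so its full norm is a p-th power in F; for k = n the norm is the socle class, which is
    nontrivial, and the condition is empty. The norm condition is also what makes the new extension
    split: with it, some lift of the inverse of s has order exactly p^n. *)

Lemma big_cycle (R : Type) (idx : R) (op : Monoid.com_law idx)
    (gT : finGroupType) (g : gT) (f : gT -> R) :
  \big[op/idx]_(x in <[g]>%g) f x = \big[op/idx]_(i < #[g]%g) f (g ^+ i)%g.
Proof.
have ->: \big[op/idx]_(x in <[g]>%g) f x =
    \big[op/idx]_(x in [set (g ^+ (i : 'I_#[g]%g))%g | i in predT]) f x.
  apply: eq_bigl => x; apply/idP/imsetP => [/cyclePmin[i lt_i ->] | [i _ ->]].
    by exists (Ordinal lt_i).
  exact: mem_cycle.
rewrite big_imset // => i j _ _ /eqP; rewrite eq_expg_mod_order.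
by rewrite !modn_small // => /eqP/val_inj.
Qed.

Section PowerClasses.

Variables (p : nat) (K : fieldType).
Implicit Types x y u v : K.

(** Equality in K^*/K^*p, kept as a relation on representatives. *)
Definition eq_pow x y := exists2 u, u != 0 & x = y * u ^+ p.
Local Notation "x ~ y" := (eq_pow x y) (at level 70).

Lemma eq_pow_refl x : x ~ x.
Proof. by exists 1; rewrite ?oner_eq0 // expr1n mulr1. Qed.

Lemma eq_pow_sym x y : x ~ y -> y ~ x.
Proof.
case=> u nzu ->; exists u^-1; first by rewrite invr_eq0.
by rewrite exprVn mulfK ?expf_neq0.
Qed.

Lemma eq_pow_trans y x w : x ~ y -> y ~ w -> x ~ w.
Proof.
case=> u nzu -> [v nzv ->]; exists (v * u); first by rewrite mulf_neq0.
by rewrite exprMn mulrA.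
Qed.

Lemma eq_powM x y x' y' : x ~ y -> x' ~ y' -> x * x' ~ y * y'.
Proof.
case=> u nzu -> [v nzv ->]; exists (u * v); first by rewrite mulf_neq0.
by rewrite exprMn mulrACA.
Qed.

Lemma eq_powX n x y : x ~ y -> x ^+ n ~ y ^+ n.
Proof.
case=> u nzu ->; exists (u ^+ n); first by rewrite expf_neq0.
by rewrite exprMn -!exprM mulnC.
Qed.

Lemma eq_pow_prod (I : Type) (r : seq I) (P : pred I) (f g : I -> K) :
    (forall i, P i -> f i ~ g i) ->
  \prod_(i <- r | P i) f i ~ \prod_(i <- r | P i) g i.
Proof.
move=> fg; elim/big_ind2: _ => //; first exact: eq_pow_refl.
by move=> *; apply: eq_powM.
Qed.

Lemma eq_pow_modn n x : x != 0 -> x ^+ (n %% p) ~ x ^+ n.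
Proof.
move=> nzx; apply: eq_pow_sym; exists (x ^+ (n %/ p)).
  by rewrite expf_neq0.
by rewrite -exprM -exprD addnC -divn_eq.
Qed.

Lemma eq_pow_cancelr w x y : w != 0 -> x * w ~ y * w -> x ~ y.
Proof.
move=> nzw xy; have := eq_powM xy (eq_pow_refl w^-1).
by rewrite !mulfK.
Qed.

Hypothesis p_pr : prime p.
Implicit Types a b : 'F_p.

(** Exponents in ['F_p] are read as natural numbers below p; the carry in an addition contributes a
    p-th power. *)
Lemma eq_powD_Fp a b x : x != 0 -> x ^+ (a + b)%R ~ x ^+ a * x ^+ b.
Proof.
move=> nzx; rewrite -exprD /= [in X in (_ %% X)%N](Fp_cast p_pr).
exact: eq_pow_modn.
Qed.

Lemma eq_powM_Fp a b x : x != 0 -> x ^+ (a * b)%R ~ (x ^+ a) ^+ b.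
Proof.
move=> nzx; rewrite -exprM /= [in X in (_ %% X)%N](Fp_cast p_pr).
exact: eq_pow_modn.
Qed.

Lemma eq_powN_Fp a x : x != 0 -> x ^+ (- a)%R ~ (x ^+ a)^-1.
Proof.
move=> nzx; apply: (@eq_pow_cancelr (x ^+ a)); first by rewrite expf_neq0.
rewrite mulVf ?expf_neq0 //; apply: eq_pow_trans (eq_pow_sym (eq_powD_Fp _ _ nzx)) _.
by rewrite addNr expr0; apply: eq_pow_refl.
Qed.

End PowerClasses.

Lemma eq_pow_morph (p : nat) (K L : fieldType) (f : {rmorphism K -> L}) x y :
  eq_pow p x y -> eq_pow p (f x) (f y).
Proof.
by case=> u nzu ->; exists (f u); rewrite ?fmorph_eq0 // rmorphM rmorphXn.
Qed.

(** * Partial norms along an automorphism, and Hilbert 90 *)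

Section Norm.

Variables (F : fieldType) (K : splittingFieldType F).
Implicit Types (s g : gal_of {:K}) (x y : K).

Lemma galM_full s g x : (s * g)%g x = g (s x).
Proof. by rewrite galM ?memvf. Qed.

Lemma galXS s i x : (s ^+ i.+1)%g x = s ((s ^+ i)%g x).
Proof. by rewrite expgSr galM_full. Qed.

Lemma galXD s i j x : (s ^+ (i + j))%g x = (s ^+ i)%g ((s ^+ j)%g x).
Proof. by rewrite addnC expgD galM_full. Qed.

Lemma gal_neq0 s x : x != 0 -> s x != 0.
Proof. by rewrite fmorph_eq0. Qed.

Lemma gal_fixX s i x : s x = x -> (s ^+ i)%g x = x.
Proof. by move=> sx; elim: i => [|i IHi]; rewrite ?gal_id // galXS IHi. Qed.

Lemma gal_comm s g x : commute s g -> g (s x) = s (g x).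
Proof. by move=> sg; rewrite -2!galM_full sg. Qed.

(** For r the order of s this is the norm to the fixed field of s; smaller r give relative norms in
    the tower of subfields. *)
Definition nrm s r x := \prod_(i < r) (s ^+ i)%g x.

Lemma nrmS s r x : nrm s r.+1 x = nrm s r x * (s ^+ r)%g x.
Proof. by rewrite /nrm big_ord_recr. Qed.

Lemma nrm0 s x : nrm s 0 x = 1.
Proof. by rewrite /nrm big_ord0. Qed.

Lemma nrmM s r x y : nrm s r (x * y) = nrm s r x * nrm s r y.
Proof. by rewrite /nrm -big_split; apply: eq_bigr => i _; rewrite rmorphM. Qed.

Lemma nrmX s r n x : nrm s r (x ^+ n) = nrm s r x ^+ n.
Proof. by rewrite /nrm -prodrXl; apply: eq_bigr => i _; rewrite rmorphXn. Qed.

Lemma nrmV s r x : nrm s r x^-1 = (nrm s r x)^-1.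
Proof. by rewrite /nrm -prodfV; apply: eq_bigr => i _; rewrite fmorphV. Qed.

Lemma nrm_prod s r (I : Type) (q : seq I) (P : pred I) (f : I -> K) :
  nrm s r (\prod_(i <- q | P i) f i) = \prod_(i <- q | P i) nrm s r (f i).
Proof. by rewrite exchange_big /=; apply: eq_bigr => i _; rewrite rmorph_prod. Qed.

Lemma nrm_neq0 s r x : x != 0 -> nrm s r x != 0.
Proof. by move=> nzx; apply/prodf_neq0 => i _; apply: gal_neq0. Qed.

Lemma nrm_fix s r x : s x = x -> nrm s r x = x ^+ r.
Proof.
move=> sx; rewrite -[r in RHS]card_ord -prodr_const.
by apply: eq_bigr => i _; rewrite gal_fixX.
Qed.

(** Applying s shifts the product, so only the two end factors change. Hence s fixes the partial
    norm of a nonzero x exactly when [s ^+ r] fixes x. *)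
Lemma nrm_tele s r x : s (nrm s r x) * x = nrm s r x * (s ^+ r)%g x.
Proof.
elim: r => [|r IHr]; first by rewrite nrm0 rmorph1 gal_id.
by rewrite nrmS rmorphM mulrAC IHr galXS.
Qed.

Lemma nrm_comm s g r x : commute s g -> g (nrm s r x) = nrm s r (g x).
Proof.
move=> sg; rewrite /nrm rmorph_prod; apply: eq_bigr => i _.
exact/gal_comm/commute_sym/commuteX/commute_sym.
Qed.

Lemma nrm_tower s a b x : nrm s (a * b) x = nrm s a (nrm (s ^+ a)%g b x).
Proof.
rewrite mulnC; elim: b => [|b IHb].
  by rewrite !nrm0 /nrm big1 // => i _; rewrite rmorph1.
rewrite mulSn addnC nrmS nrmM -IHb /nrm big_split_ord /=; congr (_ * _).
by apply: eq_bigr => i _; rewrite addnC galXD -expgM mulnC.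
Qed.


Lemma Hilbert90_cycle s x : nrm s #[s]%g x = 1 -> exists2 w, w != 0 & x = s w / w.
Proof.
move=> Nx; have gen_s: generator 'Gal({:K} / fixedField <[s]>%g) s.
  by rewrite gal_fixedField; apply: generator_cycle.
(* [Hilbert's_theorem_90] produces quotients w / s w, hence the inverse. *)
have := Hilbert's_theorem_90 gen_s (memvf x^-1).
rewrite /galNorm gal_fixedField big_cycle /=.
rewrite -[\prod_(i < _) _]/(nrm s #[s]%g x^-1) nrmV Nx invr1 eqxx.
case/elimT=> // w [_ nzw] xV; exists w => //.
by rewrite -[x]invrK xV invf_div.
Qed.

End Norm.

(** * The group ring acting on power classes *)

Section GroupRingAction.

Variables (p : nat) (F : fieldType) (K : splittingFieldType F).
Hypothesis p_pr : prime p.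
Variable s : gal_of {:K}.
Implicit Types (P Q : {poly 'F_p}) (x y : K).
Local Notation "x ~ y" := (eq_pow p x y) (at level 70).

(* The action of P(s) on power classes, with exponents in 'F_p lifted to nat. *)
Definition act P x := \prod_(i < size P) (s ^+ i)%g x ^+ (P`_i)%R.

Lemma act_widen n P x : (size P <= n)%N ->
  act P x = \prod_(i < n) (s ^+ i)%g x ^+ (P`_i)%R.
Proof.
move=> le_n; rewrite /act (big_ord_widen n (fun i => (s ^+ i)%g x ^+ (P`_i)%R)) //.
rewrite [LHS]big_mkcond; apply: eq_bigr => i _; case: ltnP => // le_i.
by rewrite nth_default // expr0.
Qed.

Lemma act_neq0 P x : x != 0 -> act P x != 0.
Proof.
by move=> nzx; apply/prodf_neq0 => i _; rewrite expf_neq0 ?gal_neq0.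
Qed.

Lemma act_eq_pow P x y : x ~ y -> act P x ~ act P y.
Proof.
by move=> xy; apply: eq_pow_prod => i _; apply/eq_powX/eq_pow_morph.
Qed.

Lemma act0 x : act 0 x = 1.
Proof. by rewrite /act size_poly0 big_ord0. Qed.

Lemma actD P Q x : x != 0 -> act (P + Q) x ~ act P x * act Q x.
Proof.
move=> nzx; set n := maxn (size P) (size Q).
rewrite !(@act_widen n) ?leq_maxl ?leq_maxr ?size_polyD // -big_split.
by apply: eq_pow_prod => i _; rewrite coefD; apply: eq_powD_Fp; rewrite ?gal_neq0.
Qed.

Lemma actZ c P x : x != 0 -> act (c *: P) x ~ act P x ^+ c.
Proof.
move=> nzx; rewrite !(@act_widen (size P)) ?size_scale_leq // -prodrXl.
apply: eq_pow_prod => i _; rewrite coefZ mulrC.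
by apply: eq_powM_Fp; rewrite ?gal_neq0.
Qed.

Lemma act_mulX P x : act (P * 'X) x = s (act P x).
Proof.
rewrite (@act_widen (size P).+1); last first.
  by rewrite (leq_trans (size_polyMleq _ _)) // size_polyX addn2.
rewrite big_ord_recl coefMX /= expr0 mul1r rmorph_prod.
by apply: eq_bigr => i _; rewrite coefMX /= -/(s _) rmorphXn galXS.
Qed.

Lemma actM P Q x : x != 0 -> act (P * Q) x ~ act P (act Q x).
Proof.
move=> nzx; elim/poly_ind: P => [|P c IHP] in Q *.
  by rewrite mul0r !act0; apply: eq_pow_refl.
have nzQ := act_neq0 Q nzx.
rewrite mulrDl; apply: eq_pow_trans (actD _ _ nzx) _.
apply: eq_pow_sym; apply: eq_pow_trans (actD _ _ nzQ) _.
apply: eq_powM; last first.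
  apply: eq_pow_sym; rewrite mul_polyC; apply: eq_pow_trans (actZ _ _ nzx) _.
  rewrite /act size_polyC; case: eqVneq => [->|_] /=.
    by rewrite big_ord0 expr0; apply: eq_pow_refl.
  by rewrite big_ord1 coefC gal_id; apply: eq_pow_refl.
rewrite act_mulX -mulrA mulrC -mulrA [Q * P]mulrC mulrC act_mulX.
by apply/eq_pow_morph/eq_pow_sym.
Qed.

Lemma act1 x : act 1 x = x.
Proof. by rewrite /act size_poly1 big_ord1 coef1 gal_id expr1. Qed.

Lemma actXn i x : act 'X^i x = (s ^+ i)%g x.
Proof.
elim: i => [|i IHi]; first by rewrite act1 gal_id.
by rewrite exprSr act_mulX IHi galXS.
Qed.

Lemma actB1 P x : x != 0 -> act (P - 1) x ~ act P x / x.
Proof.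
move=> nzx; apply: eq_pow_trans (actD _ _ nzx) _.
apply: eq_powM; first exact: eq_pow_refl.
rewrite -scaleN1r; apply: eq_pow_trans (actZ _ _ nzx) _.
by rewrite act1; apply: eq_powN_Fp.
Qed.

Lemma act_geom_exp q m x :
  x != 0 -> act (\sum_(i < m) ('X^q) ^+ i) x ~ nrm (s ^+ q)%g m x.
Proof.
move=> nzx; elim: m => [|m IHm].
  by rewrite big_ord0 act0 nrm0; apply: eq_pow_refl.
rewrite big_ord_recr nrmS; apply: eq_pow_trans (actD _ _ nzx) _.
by rewrite /= -exprM actXn expgM; apply: eq_powM => //; apply: eq_pow_refl.
Qed.

Lemma subX1_expp k : ('X - 1 : {poly 'F_p}) ^+ (p ^ k) = 'X^(p ^ k) - 1.
Proof.
have chp : p \in [pchar {poly 'F_p}].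
  by rewrite pchar_poly pchar_Fp.
elim: k => [|k IHk]; first by rewrite expn0.
by rewrite expnSr exprM IHk exprM -!(pFrobenius_autE chp) rmorphB rmorph1.
Qed.

(** Cancel X - 1 in (X - 1)^(p^k) = X^(p^k) - 1. On power classes, (s - 1)^(p^k - 1) is thus a
    partial norm ([diff_expp_pred]). *)
Lemma subX1_expp_pred k :
  ('X - 1 : {poly 'F_p}) ^+ (p ^ k).-1 = \sum_(i < p ^ k) 'X^i.
Proof.
have nzX1 : 'X - 1 != 0 :> {poly 'F_p} by rewrite -size_poly_eq0 size_XsubC.
apply: (mulfI nzX1); rewrite -subrX1 -subX1_expp -exprS.
by rewrite prednK // expn_gt0 prime_gt0.
Qed.

(** This identifies a power of s - 1 with the norm along one step of degree p in the tower of
    subfields ([diff_expp_mul]). *)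
Lemma subX1_expp_mul k :
  ('X - 1 : {poly 'F_p}) ^+ (p ^ k * p.-1) = \sum_(i < p) ('X^(p ^ k)) ^+ i.
Proof.
rewrite exprM subX1_expp.
have nzX1 : 'X^(p ^ k) - 1 != 0 :> {poly 'F_p}.
  by rewrite -size_poly_eq0 size_XnsubC ?expn_gt0 ?prime_gt0.
apply: (mulfI nzX1); rewrite -subrX1 -exprS prednK ?prime_gt0 //.
by rewrite -subX1_expp -!exprM -expnSr subX1_expp.
Qed.

Definition diff i x := act (('X - 1) ^+ i) x.

Lemma diff_neq0 i x : x != 0 -> diff i x != 0.
Proof. exact: act_neq0. Qed.

Lemma diff_add i j x : x != 0 -> diff (i + j) x ~ diff i (diff j x).
Proof. by move=> nzx; rewrite /diff exprD; apply: actM. Qed.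

Lemma diff_eq_pow i x y : x ~ y -> diff i x ~ diff i y.
Proof. exact: act_eq_pow. Qed.

Lemma diff0 x : diff 0 x = x. Proof. exact: act1. Qed.

Lemma diff1 x : x != 0 -> diff 1 x ~ s x / x.
Proof.
by move=> nzx; have := actB1 'X nzx; rewrite -['X]expr1 actXn expg1.
Qed.

Lemma diff_1 i : diff i 1 = 1.
Proof. by rewrite /diff /act big1 // => j _; rewrite rmorph1 expr1n. Qed.

Lemma diff_expp k x : x != 0 -> diff (p ^ k) x ~ (s ^+ (p ^ k))%g x / x.
Proof. by move=> nzx; rewrite /diff subX1_expp -actXn; apply: actB1. Qed.

Lemma diff_expp_pred k x : x != 0 -> diff (p ^ k).-1 x ~ nrm s (p ^ k) x.
Proof.
move=> nzx; rewrite /diff subX1_expp_pred -[X in nrm X]expg1.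
exact: (@act_geom_exp 1).
Qed.

Lemma diff_expp_mul k x :
  x != 0 -> diff (p ^ k * p.-1) x ~ nrm (s ^+ (p ^ k))%g p x.
Proof. by move=> nzx; rewrite /diff subX1_expp_mul; apply: act_geom_exp. Qed.

Lemma diff_le i j x : x != 0 -> (i <= j)%N -> diff i x ~ 1 -> diff j x ~ 1.
Proof.
move=> nzx le_ij Di; rewrite -(subnK le_ij).
apply: eq_pow_trans (diff_add _ _ nzx) _.
by have := diff_eq_pow (j - i) Di; rewrite diff_1.
Qed.

Lemma act_prod P (I : Type) (r : seq I) (A : pred I) (f : I -> K) :
  act P (\prod_(i <- r | A i) f i) = \prod_(i <- r | A i) act P (f i).
Proof.
by rewrite exchange_big; apply: eq_bigr => i _; rewrite rmorph_prod -prodrXl.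
Qed.

End GroupRingAction.

(** * Lifting the length of a power class *)

Section NormsAndPowers.

Variables (p n : nat) (F : fieldType) (K : splittingFieldType F).
Hypothesis p_pr : prime p.
Variables (s : gal_of {:K}) (z : K).
Hypotheses (ord_s : #[s]%g = (p ^ n)%N) (prim_z : p.-primitive_root z).
Hypothesis fix_z : s z = z.
Implicit Types (x y f t c : K) (g : gal_of {:K}).
Local Notation "x ~ y" := (eq_pow p x y) (at level 70).
Local Notation D := (diff p s).

(** When the fixed field of s is F, this says that x is a p-th power in F, which is stronger than
    being one in K. *)
Definition fix_pow x := exists2 c, s c = c & x = c ^+ p.

Let p_gt0 : (0 < p)%N := prime_gt0 p_pr.

(** Two p-th roots of one element differ by a power of z, which s fixes. *)
Lemma fix_root x c : s c = c -> x ^+ p = c ^+ p -> s x = x.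
Proof.
move=> sc xc; have [c0 | nzc] := eqVneq c 0.
  move/eqP: xc; rewrite c0 expr0n gtn_eqF // expf_eq0 p_gt0 => /eqP->.
  by rewrite rmorph0.
have [i xE]: {i : 'I_p | x / c = z ^+ i}.
  by apply: prim_rootP prim_z _ _; rewrite expr_div_n xc divff ?expf_neq0.
have ->: x = z ^+ i * c by rewrite -xE divfK.
by rewrite rmorphM rmorphXn /= fix_z sc.
Qed.

Lemma fix_pow_act P x : fix_pow (nrm s (p ^ n) x) ->
  fix_pow (nrm s (p ^ n) (act s (P : {poly 'F_p}) x)).
Proof.
case=> c sc Nx; exists (\prod_(i < size P) c ^+ (P`_i)%R).
  by rewrite rmorph_prod; apply: eq_bigr => i _; rewrite rmorphXn /= sc.
rewrite nrm_prod -prodrXl; apply: eq_bigr => i _.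
rewrite nrmX -nrm_comm; last exact/commuteX.
rewrite Nx rmorphXn /= (gal_fixX i sc) -!exprM mulnC //.
Qed.

Lemma gal_ord_expp k : (k <= n)%N -> #[(s ^+ (p ^ k))%g]%g = (p ^ (n - k))%N.
Proof.
move=> le_kn; rewrite orderXdiv ord_s ?dvdn_exp2l //.
by rewrite -{1}(subnK le_kn) expnD mulnK ?expn_gt0 ?p_gt0.
Qed.

Lemma gal_tele_pow g l x v f : g x = x * (f * v ^+ p) -> g f = f ->
  (g ^+ l)%g x = x * (f ^+ l * nrm g l v ^+ p) :> K.
Proof.
move=> gx gf; elim: l => [|l IHl]; first by rewrite gal_id nrm0 expr1n !mulr1.
rewrite galXS IHl !rmorphM !rmorphXn /= gx gf nrmS exprMn.
have := congr1 (fun y => y ^+ p) (nrm_tele g l v).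
by rewrite !exprMn => <-; rewrite exprS; ring.
Qed.

(* If g x = x * v ^+ p, then x ^+ (r %/ p) * half_nrm g r v is a p-th root of *)
(* nrm g r x (for p %| r), and g multiplies it by nrm g r v.                  *)
Definition half_nrm g r v := \prod_(l < r) nrm g l v.

Lemma half_nrm_tele g r v : v != 0 ->
  g (half_nrm g r v) * v ^+ r = half_nrm g r v * nrm g r v.
Proof.
move=> nzv; elim: r => [|r IHr].
  by rewrite /half_nrm big_ord0 nrm0 rmorph1.
rewrite /half_nrm big_ord_recr /= -/(half_nrm g r v) rmorphM exprSr nrmS.
have tele := nrm_tele g r v.
transitivity ((g (half_nrm g r v) * v ^+ r) * (g (nrm g r v) * v)); first by ring.
by rewrite IHr tele; ring.
Qed.

(* The p-th root C of the norm of x is fixed by s since that norm is a p-th   *)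
(* power in the base field; hence v below has norm 1, and Hilbert 90 applies. *)
Lemma descent k x : (k <= n)%N -> x != 0 -> fix_pow (nrm s (p ^ n) x) ->
    (s ^+ (p ^ k))%g x ~ x ->
  exists2 w, w != 0 & (s ^+ (p ^ k))%g (x * w ^+ p) = x * w ^+ p.
Proof.
move=> le_kn nzx [a sa Nx] [v nzv gx].
case: (ltngtP k n) le_kn => // [lt_kn _ | -> _]; last first.
  exists 1; first by rewrite oner_eq0.
  by rewrite -ord_s expg_order gal_id.
set g := (s ^+ (p ^ k))%g in gx *; set r := (p ^ (n - k))%N.
have r_p : (r %/ p * p = r)%N.
  by rewrite divnK // /r -(subnSK lt_kn) expnS dvdn_mulr.
pose c := x ^+ (r %/ p) * half_nrm g r v.
have gl l : (g ^+ l)%g x = x * nrm g l v ^+ p.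
  by rewrite (@gal_tele_pow g l x v 1) ?rmorph1 ?expr1n ?mul1r.
have nzc : c != 0.
  rewrite mulf_neq0 ?expf_neq0 //; apply/prodf_neq0 => l _; exact: nrm_neq0.
have cp : c ^+ p = nrm g r x.
  rewrite exprMn -exprM r_p -prodrXl -[r in x ^+ r]card_ord -prodr_const.
  by rewrite -big_split; apply: eq_bigr => l _; rewrite /= gl.
have gc : g c = c * nrm g r v.
  apply: (mulIf (expf_neq0 r nzv)); rewrite rmorphM rmorphXn /= -mulrA.
  rewrite half_nrm_tele // gx exprMn -exprM mulnC r_p /c.
  by ring.
have gc1 : g c = c.
  pose C := nrm s (p ^ k) c.
  have sC : s C = C.
    apply: (fix_root sa); rewrite -Nx /C -nrmX cp -nrm_tower -expnD subnKC //.
    exact: ltnW.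
  apply: (mulfI (nrm_neq0 s (p ^ k) nzc)).
  by rewrite -nrm_tele -/C sC.
have Nv : nrm g #[g]%g v = 1.
  rewrite gal_ord_expp 1?ltnW //; apply: (mulfI nzc).
  by rewrite mulr1 -gc gc1.
have [w nzw vE] := Hilbert90_cycle Nv; exists w^-1; first by rewrite invr_eq0.
rewrite rmorphM rmorphXn fmorphV /= gx vE expr_div_n -mulrA mulrAC exprVn.
by rewrite exprVn mulfV ?mul1r // expf_neq0 ?gal_neq0.
Qed.

(* f * nrm h p t is a p-th root of unity; multiplying x by the p-th power of  *)
(* a b with (h ^+ p) b = z * b, which exists as k < n, makes it equal to 1.   *)
Lemma norm_twist k x f t : (0 < k < n)%N -> x != 0 -> f != 0 -> t != 0 ->
    (s ^+ (p ^ k))%g x = x -> s f = f ->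
    (s ^+ (p ^ k.-1))%g x = x * (f * t ^+ p) ->
  exists2 y, y != 0 & nrm (s ^+ (p ^ k.-1))%g p y = f.
Proof.
case: k => // k /= lt_kn nzx nzf nzt gx sf hx; set h := (s ^+ (p ^ k))%g in hx *.
have hp : (h ^+ p)%g = (s ^+ (p ^ k.+1))%g by rewrite -expgM expnSr.
have hf : h f = f by apply: gal_fixX.
have /(prim_rootP prim_z)[i tE]: (f * nrm h p t) ^+ p = 1.
  rewrite exprMn; apply: (mulfI nzx).
  by rewrite -(gal_tele_pow p hx hf) hp gx mulr1.
have Nz : nrm (s ^+ (p ^ k.+1))%g #[(s ^+ (p ^ k.+1))%g]%g z = 1.
  rewrite gal_ord_expp 1?ltnW // nrm_fix ?gal_fixX //.
  by rewrite -(subnSK lt_kn) expnS exprM (prim_expr_order prim_z) expr1n.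
have [b nzb zE] := Hilbert90_cycle Nz.
pose u := b ^+ (p - i).
have nzu : u != 0 by rewrite expf_neq0.
pose y := t * (h u / u).
have nzy : y != 0 by rewrite !mulf_neq0 ?invr_eq0 ?gal_neq0.
exists y^-1; first by rewrite invr_eq0.
rewrite nrmV; apply: (mulIf (nrm_neq0 h p nzy)).
rewrite mulVf ?nrm_neq0 //; symmetry.
rewrite /y nrmM mulrA tE; suff -> : nrm h p (h u / u) = z ^+ (p - i).
  by rewrite -exprD (subnKC (ltnW (ltn_ord i))) (prim_expr_order prim_z).
apply: (mulIf nzu); rewrite nrmM nrmV -nrm_comm //.
apply: (mulfI (nrm_neq0 h p nzu)).
rewrite mulrA [X in X * u]mulrCA mulfV ?nrm_neq0 // mulr1 nrm_tele hp.
by rewrite /u rmorphXn /= -exprMn zE divfK.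
Qed.

(* For k = n there is no such b, and the norm condition on x is used instead; *)
(* it fails for p ^ n = 2.                                                    *)
Lemma norm_top x f t : (2 < p ^ n)%N -> (0 < n)%N -> x != 0 -> f != 0 -> t != 0 ->
    s f = f -> (s ^+ (p ^ n.-1))%g x = x * (f * t ^+ p) ->
    fix_pow (nrm s (p ^ n) x) ->
  exists2 y, y != 0 & nrm (s ^+ (p ^ n.-1))%g p y = f.
Proof.
move=> pn_gt2 n_gt0 nzx nzf nzt sf; set q := (p ^ n.-1)%N.
set h := (s ^+ q)%g => hx [a sa Nx].
have pnE : (p ^ n = q * p)%N by rewrite /q -expnSr prednK.
have hf : h f = f by apply: gal_fixX.
(* The sum is the binomial coefficient of p over 2, divisible by p when p is odd; for p = 2 the
   factor q must be even, which is where p^n > 2 is used. *)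
have [e eE] : exists e, (q * \sum_(l < p) l = e * p)%N.
  apply/dvdnP; rewrite -(big_mkord xpredT id) bin2_sum.
  have [p2|p_neq2] := eqVneq p 2%N.
    rewrite /q p2; case: n n_gt0 pn_gt2 => [|[|m]] //=; first by rewrite p2.
    by rewrite dvdn_mulr // expnS dvdn_mulr.
  rewrite dvdn_mull // prime_dvd_bin //= ltn_neqAle.
  by rewrite eq_sym p_neq2 prime_gt1.
pose c := x * half_nrm h p t.
have nzc : c != 0.
  rewrite mulf_neq0 //; apply/prodf_neq0 => l _; exact: nrm_neq0.
have cp : nrm h p x = f ^+ (\sum_(l < p) l) * c ^+ p.
  rewrite exprMn -prodrXl.
  have -> : x ^+ p = \prod_(l < p) x by rewrite prodr_const card_ord.
  rewrite expr_sum -!big_split; apply: eq_bigr => l _ /=.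
  by rewrite (gal_tele_pow l hx hf) mulrCA.
have hc : h c = c * (f * nrm h p t).
  apply: (mulIf (expf_neq0 p nzt)); rewrite rmorphM /= -mulrA half_nrm_tele // hx.
  by rewrite /c; ring.
(* f^e * C is a p-th root of the full norm of x, hence fixed by s, and so is C. Telescoping then
   gives h c = c, so f * [nrm h p t] is 1. *)
have hc1 : h c = c.
  pose C := nrm s q c.
  have sC : s (f ^+ e * C) = f ^+ e * C.
    apply: (fix_root sa); rewrite -Nx pnE nrm_tower cp nrmM nrmX nrmX nrm_fix //.
    by rewrite exprMn -!exprM eE.
  have {}sC : s C = C.
    move: sC; rewrite rmorphM rmorphXn /= sf; apply: mulfI.
    by rewrite expf_neq0.
  apply: (mulfI (nrm_neq0 s q nzc)).
  by rewrite -nrm_tele -/C sC.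
exists t^-1; first by rewrite invr_eq0.
rewrite nrmV; apply: (mulIf (nrm_neq0 h p nzt)).
rewrite mulVf ?nrm_neq0 //; apply: (mulfI nzc).
by rewrite mulr1 -hc hc1.
Qed.

(** Since f is fixed by s, s y / y has norm 1 along h = s^(p^(k-1)), so it is h w / w. Thus (s -
    1)^(p^(k-1)) w and (s - 1) y agree modulo p-th powers, and the remaining p^(k-1) (p - 1) - 1
    factors s - 1 carry the latter to the norm of y, which is f. *)
Lemma norm_D k y f : (0 < k <= n)%N -> y != 0 -> s f = f ->
    nrm (s ^+ (p ^ k.-1))%g p y = f ->
  exists w, [/\ w != 0, (s ^+ (p ^ k))%g w = w & D (p ^ k).-1 w ~ f].
Proof.
case: k => // k /= lt_kn nzy sf; set q := (p ^ k)%N; set h := (s ^+ q)%g => Ny.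
have hp : (h ^+ p)%g = (s ^+ (p ^ k.+1))%g by rewrite -expgM /q expnSr.
have nzf : f != 0 by rewrite -Ny nrm_neq0.
have Nsy : nrm h p (s y / y) = 1.
  rewrite nrmM nrmV -nrm_comm; last exact/commute_sym/commuteX.
  by rewrite Ny sf mulfV.
have hpy : (h ^+ p)%g y = y.
  apply: (mulfI nzf); rewrite -{1}Ny -nrm_tele Ny.
  by rewrite gal_fixX.
have Nsy' : nrm h #[h]%g (s y / y) = 1.
  rewrite gal_ord_expp 1?ltnW // -(subnSK lt_kn) expnS nrm_tower.
  have fix_sy : (h ^+ p)%g (s y / y) = s y / y.
    rewrite rmorphM fmorphV /= hpy; congr (_ / _).
    by rewrite gal_comm ?hpy //; apply/commuteX/commuteX.
  by rewrite (nrm_fix _ fix_sy) nrmX Nsy expr1n.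
have [w nzw wE] := Hilbert90_cycle Nsy'.
have hpw : (h ^+ p)%g w = w.
  apply: (mulfI (nrm_neq0 h p nzw)); rewrite -nrm_tele; congr (_ * _).
  move: Nsy; rewrite wE nrmM nrmV -nrm_comm // => /divr1_eq; exact.
exists w; split; rewrite -?hp //.
have qp_gt0 : (0 < q * p.-1)%N.
  by rewrite muln_gt0 expn_gt0 p_gt0 -subn1 subn_gt0 prime_gt1.
have -> : ((p ^ k.+1).-1 = (q * p.-1).-1 + q)%N.
  rewrite -[in LHS](prednK p_gt0) expnSr prednK // -/q -{1}(prednK p_gt0).
  by rewrite mulnS -{1}(prednK qp_gt0) addnC.
apply: eq_pow_trans (diff_add p_pr _ _ _ nzw) _.
have e1 : D q w ~ D 1 y.
  apply: eq_pow_trans (diff_expp p_pr _ _ nzw) _.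
  by rewrite -/h -wE; apply/eq_pow_sym/diff1.
apply: eq_pow_trans (diff_eq_pow _ _ e1) _.
apply: eq_pow_trans (eq_pow_sym (diff_add p_pr _ _ _ nzy)) _.
by rewrite addn1 prednK // -Ny; apply: diff_expp_mul.
Qed.

(** The socle class (s - 1)^(i-1) x has a representative f fixed by s. By [norm_D] it suffices that
    f be a norm along s^(p^(k-1)); [norm_twist] gives this for k < n and [norm_top] for k = n. *)
Lemma length_lift k i x : (k <= n)%N -> (p ^ k.-1 < i <= p ^ k)%N -> x != 0 ->
    D i x ~ 1 -> ~ D i.-1 x ~ 1 ->
    (nrm s (p ^ n) x ~ 1 -> fix_pow (nrm s (p ^ n) x)) ->
  exists y, [/\ y != 0, D (p ^ k).-1 y ~ D i.-1 x
              & nrm s (p ^ n) y ~ 1 -> fix_pow (nrm s (p ^ n) y)].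
Proof.
move=> le_kn /andP[gt_i le_i] nzx Di Di' Nx_pow.
have i_gt0 : (0 < i)%N by apply: leq_ltn_trans gt_i.
case: (ltngtP i (p ^ k)) le_i => // [lt_i _ | iE _]; last first.
  by exists x; split; rewrite // iE; apply: eq_pow_refl.
have k_gt0 : (0 < k)%N.
  by case: k gt_i lt_i {le_kn} => //=; rewrite expn0 => h1 h2; have := leq_trans h1 h2.
have le_pk : (p ^ k <= p ^ n)%N by rewrite leq_pexp2l.
(* As i < p^n, the class (s - 1)^(p^n - 1) x of the norm is trivial, so the norm hypothesis
   fires. *)
have Nx : fix_pow (nrm s (p ^ n) x).
  apply: Nx_pow; apply: eq_pow_trans (eq_pow_sym (diff_expp_pred p_pr _ _ nzx)) _.
  apply: diff_le Di => //; rewrite -ltnS prednK ?expn_gt0 ?p_gt0 //.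
  exact: leq_trans le_pk.
set q := (p ^ k.-1)%N in gt_i.
(* Chosen so that (s - 1)^q, which is s^q - 1, sends x0 to the socle. *)
pose x0 := D (i.-1 - q) x.
have nzx0 : x0 != 0 by apply: diff_neq0.
have Nx0 : fix_pow (nrm s (p ^ n) x0) by apply: fix_pow_act.
have fE : D q x0 ~ D i.-1 x.
  apply: eq_pow_trans (eq_pow_sym (diff_add p_pr _ _ _ nzx)) _.
  have le_q : (q <= i.-1)%N by rewrite -ltnS prednK.
  by rewrite subnKC //; apply: eq_pow_refl.
have nzDi := diff_neq0 (p) s i.-1 nzx.
have [w nzw fix_f] : exists2 w, w != 0 & s (D i.-1 x * w ^+ p) = D i.-1 x * w ^+ p.
  have := @descent 0 (D i.-1 x); rewrite expn0 expg1; apply=> //.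
    exact: fix_pow_act.
  have Di1 : D 1 (D i.-1 x) ~ 1.
    apply: eq_pow_trans (eq_pow_sym (diff_add p_pr _ _ _ nzx)) _.
    by rewrite add1n prednK.
  have := eq_pow_trans (eq_pow_sym (diff1 p_pr s nzDi)) Di1.
  move/eq_powM/(_ (eq_pow_refl p (D i.-1 x))).
  by rewrite divfK // mul1r.
set f := _ * _ in fix_f.
have f_eq : f ~ D i.-1 x by exists w.
have nzf : f != 0 by rewrite mulf_neq0 ?expf_neq0.
have hx0 : (s ^+ q)%g x0 / x0 ~ f.
  apply: eq_pow_trans (eq_pow_sym (diff_expp p_pr _ _ nzx0)) _.
  exact: eq_pow_trans fE (eq_pow_sym f_eq).
suff [y nzy Ny] : exists2 y, y != 0 & nrm (s ^+ q)%g p y = f.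
  have k_bnd : (0 < k <= n)%N by rewrite k_gt0.
  have [v [nzv gv Dv]] := norm_D k_bnd nzy fix_f Ny.
  exists v; split=> //; first exact: eq_pow_trans Dv f_eq.
  case: (ltngtP k n) le_kn => // [lt_kn _ | kn _].
    (* v is fixed by s^(p^k), so its full norm is the p^(n-k)-th power of its norm of length p^k. *)
    move=> _; exists (nrm s (p ^ k) v ^+ (p ^ (n - k).-1)).
      rewrite rmorphXn; congr (_ ^+ _); apply: (mulIf nzv).
      by rewrite nrm_tele gv.
    rewrite -exprM -expnSr prednK ?subn_gt0 // -nrmX -(nrm_fix _ gv).
    by rewrite -nrm_tower -expnD subnKC // ltnW.
  (* For k = n the norm of v is the class of f, which is nontrivial, so the premise is absurd. *)
  rewrite -kn => Nv; case: Di'.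
  apply: eq_pow_trans (eq_pow_sym f_eq) _; apply: eq_pow_trans Nv.
  exact: eq_pow_trans (eq_pow_sym Dv) (diff_expp_pred p_pr _ _ nzv).
have x0E : (s ^+ q)%g x0 / x0 ~ f -> exists2 t, t != 0 & (s ^+ q)%g x0 = x0 * (f * t ^+ p).
  by case=> t nzt e; exists t; rewrite // -e mulrCA mulfV ?mulr1.
case: (ltngtP k n) le_kn => // [lt_kn _ | kn _]; last first.
  have [t nzt ht] := x0E hx0; rewrite /q kn in ht *.
  apply: norm_top nzx0 nzf nzt fix_f ht Nx0; last by rewrite -kn.
  by rewrite -kn; apply: leq_trans lt_i; rewrite ltnS; apply: leq_trans gt_i; rewrite ltnS expn_gt0 p_gt0.
(* Since i < p^k, (s - 1)^(p^k) kills the class of x0; [descent] then moves x0 into the fixed field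
   of s^(p^k). *)
have Dq1 : (s ^+ (p ^ k))%g x0 ~ x0.
  have : D (p ^ k) x0 ~ 1.
    apply: eq_pow_trans (eq_pow_sym (diff_add p_pr _ _ _ nzx)) _.
    apply: diff_le Di => //; rewrite (leq_trans (ltnW lt_i)) // leq_addr //.
  move/(eq_pow_trans (eq_pow_sym (diff_expp p_pr _ _ nzx0))).
  move/eq_powM/(_ (eq_pow_refl p x0)); by rewrite divfK // mul1r.
have [v nzv gv] := descent (ltnW lt_kn) nzx0 Nx0 Dq1.
have nzx1 : x0 * v ^+ p != 0 by rewrite mulf_neq0 ?expf_neq0.
have [t nzt ht] := x0E hx0.
apply: (@norm_twist k (x0 * v ^+ p) f (t * ((s ^+ q)%g v / v))) => //.
- by rewrite k_gt0.
- by rewrite !mulf_neq0 ?invr_eq0 ?gal_neq0.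
rewrite rmorphM rmorphXn /= ht !exprMn exprVn; field.
by rewrite expf_neq0.
Qed.

End NormsAndPowers.

(** * Jordan coordinates of cyclic modules *)

Section JordanCoordinates.

Variable p : nat.
Hypothesis p_pr : prime p.

(* Coordinates in a Jordan basis of R with block sizes l, where R - 1 maps    *)
(* each basis vector of a block to the next; values of k outside the range    *)
(* j < size l, h < nth 0 l j are junk.                                        *)
Definition jcoord m (R : 'M['F_p]_m) (l : seq nat)
    (k : 'rV['F_p]_m -> nat -> nat -> 'F_p) :=
  [/\ forall u v j h, k (u + v) j h = k u j h + k v j h,
      forall u, (forall j h, (j < size l)%N -> (h < nth 0%N l j)%N -> k u j h = 0)
         -> u = 0,
      forall c : nat -> nat -> 'F_p, exists u, forall j h,
         (j < size l)%N -> (h < nth 0%N l j)%N -> k u j h = c j h,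
      forall u j, (j < size l)%N -> k (u *m R) j 0%N = k u j 0%N
    & forall u j h, (j < size l)%N -> (h.+1 < nth 0%N l j)%N ->
         k (u *m R) j h.+1 = k u j h.+1 + k u j h].

Lemma jcoord_nil (R : 'M['F_p]_0) : exists k, jcoord R [::] k.
Proof.
exists (fun _ _ _ => 0); split=> //; last by move=> c; exists 0.
- by move=> u v j h; rewrite addr0.
- by move=> u _; rewrite thinmx0.
Qed.

Lemma jcoord_block m1 m2 (R1 : 'M['F_p]_m1) (R2 : 'M['F_p]_m2) l1 l2 :
    (exists k, jcoord R1 l1 k) -> (exists k, jcoord R2 l2 k) ->
  exists k, jcoord (block_mx R1 0 0 R2) (l1 ++ l2) k.
Proof.
move=> [k1 [D1 I1 S1 Z1 A1]] [k2 [D2 I2 S2 Z2 A2]].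
exists (fun u j h => if (j < size l1)%N then k1 (lsubmx u) j h
                     else k2 (rsubmx u) (j - size l1)%N h).
have subK j : (j < size (l1 ++ l2))%N -> (size l1 <= j)%N -> (j - size l1 < size l2)%N.
  by move=> lt_j le_j; rewrite ltn_subLR // -size_cat.
have RE u : u *m block_mx R1 0 0 R2 = row_mx (lsubmx u *m R1) (rsubmx u *m R2).
  by rewrite -{1}[u]hsubmxK mul_row_block !mulmx0 addr0 add0r.
split=> [u v j h | u u0 | c | u j lt_j | u j h lt_j].
- by case: ifP => _; rewrite linearD ?D1 ?D2.
- have l0 : lsubmx u = 0.
    apply: I1 => j h lt_j lt_h; have := u0 j h.
    by rewrite size_cat nth_cat lt_j ltn_addr //; apply.
  have r0 : rsubmx u = 0.
    apply: I2 => j h lt_j lt_h; have := u0 (size l1 + j)%N h.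
    have nlt : (size l1 + j < size l1)%N = false by rewrite ltnNge leq_addr.
    by rewrite size_cat ltn_add2l nth_cat nlt addKn; apply.
  by rewrite -(hsubmxK u) l0 r0 row_mx0.
- have [u1 u1E] := S1 c; have [u2 u2E] := S2 (fun j => c (size l1 + j)%N).
  exists (row_mx u1 u2) => j h lt_j; rewrite row_mxKl row_mxKr nth_cat.
  case: (ltnP j (size l1)) => [lt_j1 | le_j] lt_h; first exact: u1E.
  by rewrite u2E ?subnKC ?subK.
- rewrite RE row_mxKl row_mxKr; case: (ltnP j (size l1)) => [/Z1-> // | le_j].
  by rewrite Z2 ?subK.
- rewrite RE row_mxKl row_mxKr nth_cat; case: (ltnP j (size l1)) => [lt_j1 | le_j] lt_h.
    exact: A1.
  by rewrite A2 ?subK.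
Qed.

Lemma jcoord_sim m1 m2 (R1 : 'M['F_p]_m1) (R2 : 'M['F_p]_m2) B l :
    m1 = m2 -> row_free B -> R1 *m B = B *m R2 ->
  (exists k, jcoord R2 l k) -> exists k, jcoord R1 l k.
Proof.
move=> m12; case: _ / m12 in R2 B * => freeB RB [k [D I S Z A]].
exists (fun u => k (u *m B)).
have REB u : u *m R1 *m B = u *m B *m R2 by rewrite -!mulmxA RB.
split=> [u v j h | u u0 | c | u j lt_j | u j h lt_j lt_h].
- by rewrite mulmxDl D.
- by apply: (row_free_inj freeB); rewrite mul0mx; apply: I.
- have [u uE] := S c; exists (u *m invmx B) => j h lt_j lt_h.
  by rewrite mulmxKV ?uE // -row_free_unit.
- by rewrite REB Z.
- by rewrite REB A.
Qed.

(** In a vanishing combination, multiplying by U^(e-1-i) kills the terms beyond i, and those before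
    i vanish by induction, so the coefficient at i is 0. *)
Lemma chain_free m (U : 'M['F_p]_m) (w : 'rV_m) e :
    w *m U ^+ e = 0 -> w *m U ^+ e.-1 != 0 ->
  row_free (\matrix_(i < e) (w *m U ^+ i)).
Proof.
move=> we we1; apply: inj_row_free => c; rewrite mulmx_sum_row => c0.
apply/rowP=> i; rewrite mxE; have [n le_in] := ubnP (i : nat).
elim: n => // n IHn in i le_in *.
have lt_c (j : 'I_e) : (j < i)%N -> c 0 j = 0.
  by move=> lt_ji; apply: IHn; apply: leq_trans lt_ji _; rewrite -ltnS.
have := congr1 (fun v => v *m U ^+ (e.-1 - i)) c0.
rewrite mul0mx mulmx_suml (bigD1 i) //= big1 => [|j neq_ji].
  rewrite addr0 rowK -scalemxAl -mulmxA mulmxE -exprD subnKC; last first.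
    by rewrite -ltnS (ltn_predK (ltn_ord i)).
  move/eqP; rewrite scalemx_eq0 (negPf we1) orbF => /eqP; exact.
rewrite rowK -scalemxAl; case: (ltngtP j i) => [/lt_c-> | lt_ij | /val_inj ji].
- by rewrite scale0r.
- rewrite -mulmxA mulmxE -exprD.
  have -> : (j + (e.-1 - i) = e + (j - i.+1))%N.
    have := ltn_ord j; have := ltn_ord i; lia.
  by rewrite exprD -mulmxE mulmxA we mul0mx scaler0.
- by rewrite ji eqxx in neq_ji.
Qed.

Lemma jcoord1 m (R : 'M['F_p]_m) (w : 'rV_m) e : m = e ->
    w *m (R - 1%:M) ^+ e = 0 -> w *m (R - 1%:M) ^+ e.-1 != 0 ->
  exists k, jcoord R [:: e] k.
Proof.
move=> <- w0 nzw; set U := R - 1%:M in w0 nzw.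
pose V := \matrix_(i < m) (w *m U ^+ i).
have freeV : row_free V by apply: chain_free.
have unitV : V \in unitmx by rewrite -row_free_unit.
pose N : 'M['F_p]_m := \matrix_(i, j) (j == i.+1 :> nat)%:R.
have VR : V *m R = (1%:M + N) *m V.
  have -> : R = 1%:M + U by rewrite addrC subrK.
  rewrite mulmxDr mulmxDl mulmx1 mul1mx; congr (_ + _).
  apply/row_matrixP=> i; rewrite !row_mul rowK -mulmxA mulmxE -exprSr.
  rewrite [RHS]mulmx_sum_row; under eq_bigr do rewrite mxE mxE.
  have [lt_i | le_i] := ltnP i.+1 m.
    rewrite (bigD1 (Ordinal lt_i)) //= eqxx scale1r rowK big1 ?addr0 // => j neq_j.
    case: eqP => [ji | _]; last by rewrite scale0r.
    by case/eqP: neq_j; apply: val_inj.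
  rewrite big1 => [|j _]; last first.
    by rewrite ltn_eqF ?scale0r // (leq_trans (ltn_ord j)).
  by have -> : i.+1 = m by apply/eqP; rewrite eqn_leq le_i ltn_ord.
pose k (u : 'rV_m) (j h : nat) := \sum_(i < m | i == h :> nat) (u *m invmx V) 0 i.
have kE u j h (lt_h : (h < m)%N) : k u j h = (u *m invmx V) 0 (Ordinal lt_h).
  by rewrite /k (big_pred1 (Ordinal lt_h)).
have kR u : u *m R *m invmx V = u *m invmx V *m (1%:M + N).
  apply: (canLR (mulmxK unitV)).
  by rewrite -!mulmxA -VR !mulmxA mulmxKV.
exists k; split=> [u v j h | u u0 | c | u [] // _ | u [] // h _ lt_h].
- by rewrite /k -big_split; apply: eq_bigr => i _; rewrite mulmxDl mxE.
- have uV0 : u *m invmx V = 0.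
    apply/rowP=> i; rewrite [RHS]mxE -(u0 0%N i) //= (kE u 0%N i (ltn_ord i)).
    by congr (_ 0 _); apply: val_inj.
  by rewrite -(mulmxKV unitV u) uV0 mul0mx.
- exists ((\row_i c 0%N i) *m V) => [[]] // h _ lt_h.
  by rewrite kE mulmxK // mxE.
- rewrite /k kR mulmxDr mulmx1; apply: eq_bigr => i /eqP i0.
  rewrite mxE [X in _ + X]mxE big1 ?addr0 // => j _.
  by rewrite [N _ _]mxE i0 mulr0.
- rewrite !kE ?(ltnW lt_h) // => lt_h'; rewrite kR mulmxDr mulmx1 mxE; congr (_ + _).
  rewrite mxE (bigD1 (Ordinal lt_h')) //= [N _ _]mxE eqxx mulr1 big1 ?addr0 // => j neq_j.
  rewrite [N _ _]mxE eqSS; case: eqP => [hj | _]; last by rewrite mulr0.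
  by case/eqP: neq_j; apply: val_inj.
Qed.

Lemma mx_subX1_expp m (R : 'M['F_p]_m) k :
  (R - 1%:M) ^+ (p ^ k) = R ^+ (p ^ k) - 1%:M.
Proof.
case: m R => [|m] R; first by rewrite [LHS]thinmx0 [RHS]thinmx0.
have chp : p \in [pchar 'M['F_p]_m.+1].
  by rewrite pchar_lalg pchar_Fp.
elim: k => [|k IHk]; first by rewrite expn0.
rewrite expnSr exprM IHk exprM -!(pFrobenius_autE chp).
by rewrite pFrobenius_autB_comm ?pFrobenius_aut1 //; apply: commr1.
Qed.

Variables (gT : finGroupType) (s : gT) (n : nat).
Hypothesis ord_s : #[s]%g = (p ^ n)%N.
Local Notation aG := (regular_repr 'F_p <[s]>%g).
Let U := aG s - 1%:M.

Lemma aug_powM i j : aug_pow p s (i + j) = aug_pow p s i *m U ^+ j.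
Proof. by rewrite /aug_pow exprD -mulmxE gring_row_mul. Qed.

Lemma reprX i : aG (s ^+ i)%g = aG s ^+ i.
Proof.
elim: i => [|i IHi]; first by rewrite repr_mx1.
by rewrite expgSr repr_mxM ?mem_cycle ?cycle_id // IHi exprSr mulmxE.
Qed.

Lemma aug_pow_top : aug_pow p s (p ^ n) = 0.
Proof.
by rewrite /aug_pow mx_subX1_expp -reprX -ord_s expg_order repr_mx1 subrr linear0.
Qed.

(** In the binomial expansion of (s - 1)^(p^n - 1), only the constant term contributes to the
    coordinate at the identity, which is therefore 1 or -1. *)
Lemma aug_pow_bot : aug_pow p s (p ^ n).-1 != 0.
Proof.
pose i1 := gring_index <[s]>%g 1%g.
apply/eqP => /rowP/(_ i1)/eqP; rewrite [X in _ == X]mxE mxE.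
rewrite exprBn_comm; last exact: commr1.
have pn_gt0 : (0 < p ^ n)%N by rewrite expn_gt0 prime_gt0.
set r := (p ^ n).-1; have rE : r.+1 = (p ^ n)%N by rewrite prednK.
rewrite summxE big_ord_recr /= big1 ?add0r => [|i _].
  rewrite binn subnn expr0 expr1n mulr1 mulr1 -signr_odd.
  by case: (odd r); rewrite ?expr1 ?expr0 !mxE eqxx ?mulN1r ?oppr_eq0 ?oner_eq0.
rewrite expr1n mulr1 -signr_odd -reprX.
suff e0 : aG (s ^+ (r - i))%g i1 i1 = 0.
  rewrite mulmxnE; case: (odd i); rewrite ?expr1 ?expr0 ?mulN1r ?mul1r.
    by rewrite mxE e0 oppr0 mul0rn.
  by rewrite e0 mul0rn.
rewrite /= /regular_mx mxE mxE eqxx /= gring_indexK ?group1 // mul1g.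
case: eqP => // /(congr1 enum_val); rewrite !gring_indexK ?group1 ?mem_cycle //.
move/esym/eqP; rewrite -order_dvdn ord_s -rE => /dvdn_leq.
have := ltn_ord i; lia.
Qed.

(** Free chains bound the dimension of the quotient below by e and that of the ideal by p^n - e. The
    two dimensions add up to p^n, so the quotient has dimension e and is a single Jordan block. *)
Lemma jcoord_cyc_mod e : (0 < e <= p ^ n)%N ->
  exists k, jcoord (cyc_mod p s e s) [:: e] k.
Proof.
case/andP=> e_gt0 le_e; set q := (p ^ n)%N in le_e.
pose V := cyclic_mx aG (aug_pow p s e).
have UcommX x : x \in <[s]>%g -> GRing.comm (aG x) U.
  case/cycleP=> i ->; rewrite reprX; apply: commrB; last exact: commr1.
  exact/commr_sym/commrX.
(* (s - 1)^(q-e) kills the ideal but not (s - 1)^(e-1), so the latter lies outside the ideal. *)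
have V0 : V *m U ^+ (q - e) = 0.
  apply/sub_kermxP; apply: cyclic_mx_sub.
    apply/mxmoduleP=> x Gx; apply/sub_kermxP.
    rewrite -mulmxA mulmxE (commrX _ (UcommX x Gx)) -mulmxE mulmxA.
    by rewrite mulmx_ker mul0mx.
  by apply/sub_kermxP; rewrite -aug_powM subnKC // aug_pow_top.
have bot : aug_pow p s e.-1 *m U ^+ (q - e) != 0.
  by rewrite -aug_powM (_ : _ + _ = q.-1)%N ?aug_pow_bot //; lia.
have botV : ~~ (aug_pow p s e.-1 <= V)%MS.
  by apply: contra bot => /submxP[A ->]; rewrite -mulmxA V0 mulmx0.
pose modV := cyclic_mx_module aG (aug_pow p s e).
pose w := in_factmod V (aug_pow p s 0).
pose R := factmod_repr modV s.
have wX i : w *m (R - 1%:M) ^+ i = in_factmod V (aug_pow p s i).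
  elim: i => [|i IHi]; first by rewrite mulmx1.
  rewrite exprSr -mulmxE mulmxA IHi mulmxBr mulmx1 -(addn1 i) aug_powM expr1.
  by rewrite mulmxBr mulmx1 linearB /= -in_factmodJ ?cycle_id.
have we : w *m (R - 1%:M) ^+ e = 0.
  by apply/eqP; rewrite wX in_factmod_eq0 cyclic_mx_id.
have we1 : w *m (R - 1%:M) ^+ e.-1 != 0 by rewrite wX in_factmod_eq0.
have le_rank : (e <= \rank (cokermx V))%N.
  have /eqP <- := chain_free we we1; exact: rank_leq_col.
have le_rankV : (q - e <= \rank V)%N.
  have v0 : aug_pow p s e *m U ^+ (q - e) = 0.
    by rewrite -aug_powM subnKC // aug_pow_top.
  case: (ltngtP e q) le_e => // [lt_e _ | -> _]; last by rewrite subnn.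
  have v1 : aug_pow p s e *m U ^+ (q - e).-1 != 0.
    by rewrite -aug_powM (_ : _ + _ = q.-1)%N ?aug_pow_bot //; lia.
  have /eqP <- := chain_free v0 v1; apply: mxrankS.
  apply/row_subP=> i; rewrite rowK.
  elim: (i : nat) => [|j IHj]; first by rewrite mulmx1 cyclic_mx_id.
  rewrite exprSr -mulmxE mulmxA mulmxBr mulmx1 addmx_sub //.
    by apply: mxmodule_trans; rewrite ?cycle_id.
  by rewrite -scaleN1r scalemx_sub.
have rkE : \rank (cokermx V) = e.
  move: le_rank le_rankV; rewrite mxrank_coker.
  have : gcard <[s]>%g = q by exact: ord_s.
  by move: (\rank V) => a b; lia.
exact: jcoord1 rkE we we1.
Qed.

Definition blocks N (d e : nat -> nat) :=
  flatten [seq nseq (d i) (e i) | i <- index_iota 1 N.+1].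

Lemma jcoord_muln (rG : representation 'F_p <[s]>%G) d l :
  (exists k, jcoord (rG s) l k) ->
  exists k, jcoord (muln_grepr rG d s) (flatten (nseq d l)) k.
Proof.
move=> rGl; rewrite /muln_grepr; elim: d => [|d IHd].
  by rewrite big_ord0; apply: jcoord_nil.
by rewrite big_ord_recl; apply: jcoord_block.
Qed.

Lemma jcoord_cyc_sum N d e :
    (forall i, (0 < i <= N)%N -> (0 < e i <= p ^ n)%N) ->
  exists k, jcoord (cyc_sum p s N d e s) (blocks N d e) k.
Proof.
rewrite /cyc_sum /blocks => e_bnd.
have : {in index_iota 1 N.+1, forall i, (0 < e i <= p ^ n)%N}.
  by move=> i; rewrite mem_index_iota ltnS; apply: e_bnd.
elim: index_iota => [|i r IHr] eP /=; first by rewrite big_nil; apply: jcoord_nil.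
rewrite big_cons; apply: jcoord_block; last first.
  by apply: IHr => j rj; rewrite eP // inE rj orbT.
have := @jcoord_muln (cyc_mod p s (e i)) (d i) [:: e i].
rewrite (_ : flatten (nseq (d i) [:: e i]) = nseq (d i) (e i)); last first.
  by elim: (d i) => //= m ->.
by apply; apply: jcoord_cyc_mod; rewrite eP ?mem_head.
Qed.

End JordanCoordinates.

(** * Strings of power classes, and their prolongation *)

Section RadicalData.

Variables (p n : nat) (F : fieldType).
Hypothesis p_pr : prime p.
Variable K : splittingFieldType F.
Implicit Types (s : gal_of {:K}) (l : seq nat) (b : nat -> nat -> K).

Definition combo l b (c : nat -> nat -> 'F_p) :=
  \prod_(j < size l) \prod_(g < nth 0%N l j) b j g ^+ c j g.

(* s - 1 maps the class of b j g.+1 to that of b j g, so blocks are indexed   *)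
(* from their socle upwards, dually to jcoord. radical_norm is the condition  *)
(* for the Galois group generated by the p-th roots of the b j g to split.    *)
Record radical_data s l b : Prop := RadicalData {
  radical_neq0 : forall j g, b j g != 0;
  radical_fix : forall j, (j < size l)%N -> eq_pow p (s (b j 0%N)) (b j 0%N);
  radical_next : forall j g, (j < size l)%N -> (g.+1 < nth 0%N l j)%N ->
    eq_pow p (s (b j g.+1)) (b j g.+1 * b j g);
  radical_free : forall c, eq_pow p (combo l b c) 1 ->
    forall j g, (j < size l)%N -> (g < nth 0%N l j)%N -> c j g = 0;
  radical_norm : forall j, (j < size l)%N ->
    let y := nrm s (p ^ n) (b j (nth 0%N l j).-1) in
    eq_pow p y 1 -> fix_pow p s y
}.

Variables (s : gal_of {:K}) (z : K) (l : seq nat) (b : nat -> nat -> K).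
Hypotheses (ord_s : #[s]%g = (p ^ n)%N) (prim_z : p.-primitive_root z).
Hypotheses (fix_z : s z = z) (data_b : radical_data s l b).
Hypothesis l_bnd : {in l, forall i, 0 < i <= p ^ n}%N.
Local Notation "x ~ y" := (eq_pow p x y) (at level 70).
Local Notation D := (diff p s).

Lemma diff_radical j g : (j < size l)%N -> (g < nth 0%N l j)%N ->
  D 1 (b j g) ~ (if g is g'.+1 then b j g' else 1).
Proof.
move=> lt_j lt_g; have nzb := radical_neq0 data_b j.
apply: eq_pow_trans (diff1 p_pr s (nzb g)) _.
apply: (@eq_pow_cancelr p K (b j g)); first exact: nzb.
rewrite divfK //; case: g lt_g => [|g] lt_g.
  by rewrite mul1r; apply: (radical_fix data_b).
by rewrite mulrC; apply: (radical_next data_b).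
Qed.

Lemma diff_radical_iter j g i : (j < size l)%N -> (g + i < nth 0%N l j)%N ->
  D i (b j (g + i)%N) ~ b j g.
Proof.
move=> lt_j; have nzb := radical_neq0 data_b j.
elim: i => [|i IHi] lt_i; first by rewrite diff0 addn0; apply: eq_pow_refl.
rewrite -addn1; apply: eq_pow_trans (diff_add p_pr s _ _ (nzb _)) _.
rewrite addn1 addnS; apply: eq_pow_trans (IHi _); last by rewrite -addnS ltnW ?addnS // -addnS.
apply: diff_eq_pow; have := @diff_radical j (g + i).+1 lt_j; apply.
by rewrite -addnS.
Qed.

Lemma radical_bot_neq1 j : (j < size l)%N -> ~ b j 0%N ~ 1.
Proof.
move=> lt_j bj; have /andP[lj_gt0 _] := l_bnd (mem_nth 0%N lt_j).
pose c (j' g : nat) : 'F_p := ((j' == j) && (g == 0%N))%:R.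
have := @radical_free _ _ _ data_b c _ j 0%N lt_j lj_gt0.
suff: combo l b c ~ 1.
  by move=> h /(_ h)/eqP; rewrite /c !eqxx oner_eq0.
have -> : combo l b c = b j 0%N.
  rewrite /combo (bigD1 (Ordinal lt_j)) //= (bigD1 (Ordinal lj_gt0)) //= /c !eqxx.
  rewrite /= !big1 ?mulr1 ?expr1 //.
  - move=> j'; rewrite -val_eqE /= => /negPf neq.
    by rewrite big1 // => g _; rewrite neq expr0.
  - by move=> g; rewrite -val_eqE /= => /negPf->; rewrite expr0.
exact: bj.
Qed.

Let ceil i := (p ^ up_log p i)%N.

Lemma ceil_bnd i : (0 < i <= p ^ n)%N -> (i <= ceil i <= p ^ n)%N.
Proof.
move=> /andP[i_gt0 le_i]; rewrite up_logP ?prime_gt1 //=.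
by rewrite leq_pexp2l ?prime_gt0 // up_log_min ?prime_gt1.
Qed.

Lemma chain_lift j : (j < size l)%N ->
  exists y, [/\ y != 0, D (ceil (nth 0%N l j)).-1 y ~ b j 0%N
              & nrm s (p ^ n) y ~ 1 -> fix_pow p s (nrm s (p ^ n) y)].
Proof.
move=> lt_j; have /andP[lj_gt0 le_lj] := l_bnd (mem_nth 0%N lt_j).
set i := nth 0%N l j in lj_gt0 le_lj *; pose x := b j i.-1.
have nzx : x != 0 by apply: radical_neq0 data_b _ _.
have Dx : D i.-1 x ~ b j 0%N.
  by have := @diff_radical_iter j 0 i.-1 lt_j; rewrite add0n -/i prednK //; apply.
have Nx := radical_norm data_b lt_j; rewrite -/i -/x /= in Nx.
(* For i = 1 the exponent is k = 0, and the strict bound p^(k.-1) < i of [length_lift] fails; the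
   string already has length p^0. *)
have [i1 | i_neq1] := eqVneq i 1%N.
  exists x; split=> //; rewrite /ceil i1 up_log1 expn0.
  by rewrite i1 in Dx.
have i_gt1 : (1 < i)%N by rewrite ltn_neqAle eq_sym i_neq1.
have Dix : D i x ~ 1.
  rewrite -(prednK lj_gt0) -add1n.
  apply: eq_pow_trans (diff_add p_pr s _ _ nzx) _.
  apply: eq_pow_trans (diff_eq_pow s 1 Dx) _.
  by have := @diff_radical j 0 lt_j lj_gt0.
have Dix' : ~ D i.-1 x ~ 1.
  by move=> Dx1; apply: (radical_bot_neq1 lt_j); apply: eq_pow_trans Dx1; apply: eq_pow_sym.
have k_bnd : (p ^ (up_log p i).-1 < i <= p ^ up_log p i)%N.
  exact: (up_log_bounds (prime_gt1 p_pr) i_gt1).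
have le_k : (up_log p i <= n)%N by rewrite up_log_min ?prime_gt1.
have [y [nzy Dy Ny]] := length_lift p_pr ord_s prim_z fix_z le_k k_bnd nzx Dix Dix' Nx.
by exists y; split=> //; apply: eq_pow_trans Dy Dx.
Qed.

(** Each new string consists of the images of a lifted top under powers of s - 1. Its socle agrees
    with the old one modulo p-th powers, so independence is inherited from the old socles. *)
Lemma radical_lift : exists b', radical_data s (map ceil l) b'.
Proof.
have [y yP] : exists y : nat -> K, forall j, (j < size l)%N ->
    [/\ y j != 0, D (ceil (nth 0%N l j)).-1 (y j) ~ b j 0%N
      & nrm s (p ^ n) (y j) ~ 1 -> fix_pow p s (nrm s (p ^ n) (y j))].
  (* Finite choice, by induction on the number of blocks. *)
  have : forall m, (m <= size l)%N -> exists y : nat -> K, forall j, (j < m)%N ->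
    [/\ y j != 0, D (ceil (nth 0%N l j)).-1 (y j) ~ b j 0%N
      & nrm s (p ^ n) (y j) ~ 1 -> fix_pow p s (nrm s (p ^ n) (y j))].
    elim=> [|m IHm] le_m; first by exists (fun=> 1).
    have [y yP] := IHm (ltnW le_m); have [y' y'P] := chain_lift le_m.
    exists (fun j => if j == m then y' else y j) => j.
    by rewrite ltnS leq_eqVlt; case: eqP => [-> // | _] /= /yP.
  by move/(_ _ (leqnn _)).
pose l' := map ceil l.
have size_l' : size l' = size l by rewrite size_map.
have l'E j : (j < size l)%N -> nth 0%N l' j = ceil (nth 0%N l j).
  by move=> lt_j; rewrite (nth_map 0%N).
have ceil_gt0 i : (0 < ceil i)%N by rewrite expn_gt0 prime_gt0.
pose b' j g := if (j < size l)%N then D ((nth 0%N l' j).-1 - g) (y j) else 1.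
have nzb' j g : b' j g != 0.
  rewrite /b'; case: ifP => [/yP[nzy _ _] | _]; last exact: oner_neq0.
  exact: diff_neq0.
have Db'0 j : (j < size l)%N -> b' j 0%N ~ b j 0%N.
  by move=> lt_j; rewrite /b' lt_j subn0 l'E //; have [] := yP j lt_j.
have Db' j g : (j < size l)%N -> (g < nth 0%N l' j)%N ->
    D 1 (b' j g) ~ (if g is g'.+1 then b' j g' else 1).
  move=> lt_j lt_g; case: g lt_g => [|g] lt_g.
    apply: eq_pow_trans (diff_eq_pow s 1 (Db'0 j lt_j)) _.
    have /andP[lj_gt0 _] := l_bnd (mem_nth 0%N lt_j).
    exact: (@diff_radical j 0 lt_j lj_gt0).
  rewrite /b' lt_j; have [nzy _ _] := yP j lt_j.
  apply: eq_pow_trans (eq_pow_sym (diff_add p_pr s _ _ nzy)) _.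
  rewrite add1n subnSK; first exact: eq_pow_refl.
  by rewrite -ltnS prednK // l'E.
have sb' j g : (j < size l)%N -> (g < nth 0%N l' j)%N ->
    s (b' j g) ~ b' j g * (if g is g'.+1 then b' j g' else 1).
  move=> lt_j lt_g; rewrite mulrC.
  have := eq_pow_trans (eq_pow_sym (diff1 p_pr s (nzb' j g))) (Db' j g lt_j lt_g).
  move/eq_powM/(_ (eq_pow_refl p (b' j g))); by rewrite divfK.
exists b'; split=> //.
- move=> j; rewrite size_l' => lt_j; have := sb' j 0%N lt_j.
  by rewrite mulr1 l'E //; apply.
- by move=> j g; rewrite size_l' => lt_j; apply: sb'.
- move=> c cb'.
  (* Coefficients are cut to 0 outside the blocks, so that a shift brings in no junk at the top. *)
  pose tr (c : nat -> nat -> 'F_p) j g := if (g < nth 0%N l' j)%N then c j g else 0.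
  have tr_combo c' : combo l' b' (tr c') = combo l' b' c'.
    by apply: eq_bigr => j _; apply: eq_bigr => g _; rewrite /tr ltn_ord.
  (* Applying s - 1 to a relation moves each coefficient one place towards the socle and drops those
     on the socle. *)
  have shift c' : combo l' b' (tr c') ~ 1 -> combo l' b' (tr (fun j g => tr c' j g.+1)) ~ 1.
    move=> /(diff_eq_pow s 1); rewrite diff_1; apply: eq_pow_trans.
    rewrite tr_combo /combo /diff act_prod; apply: eq_pow_prod => j _.
    have lt_j : (j < size l)%N by rewrite -size_l'.
    rewrite act_prod.
    have DX x e : act s (('X - 1) ^+ 1 : {poly 'F_p}) (x ^+ e) = D 1 x ^+ e.
      have := act_prod s (('X - 1) ^+ 1 : {poly 'F_p}) (index_enum 'I_e) xpredT (fun=> x).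
      by rewrite !prodr_const card_ord.
    under [X in _ ~ X]eq_bigr do rewrite DX //.
    have l'j_gt0 : (0 < nth 0%N l' j)%N by rewrite l'E.
    rewrite -(prednK l'j_gt0) big_ord_recr [X in _ ~ X]big_ord_recl /=.
    rewrite {2}/tr prednK // ltnn expr0 mulr1.
    apply: eq_pow_trans (_ : 1 * _ ~ _); first by rewrite mul1r; apply: eq_pow_refl.
    apply: eq_powM.
      have := eq_powX (tr c' j 0%N) (Db' j 0%N lt_j l'j_gt0).
      by rewrite expr1n => /eq_pow_sym.
    apply: eq_pow_prod => g _; apply/eq_pow_sym/eq_powX.
    by apply: (Db' j g.+1) => //; rewrite -[X in (_ < X)%N]prednK // ltnS.
  (* M bounds the heights in use and drops under [shift]. By induction only socle coefficients
     remain, and these form a relation between the old socles. *)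
  have zero M : forall c', combo l' b' (tr c') ~ 1 ->
      (forall j g, (j < size l)%N -> (M <= g)%N -> tr c' j g = 0) ->
      forall j g, (j < size l)%N -> tr c' j g = 0.
    elim: M => [|M IHM] c' c'b' c'0 j g lt_j; first exact: c'0.
    have sh0 : forall j g, (j < size l)%N -> tr (fun j g => tr c' j g.+1) j g = 0.
      apply: IHM => [|j1 g1 lt_j1 le_g1]; first exact: shift.
      by rewrite {1}/tr; case: ifP => // _; apply: c'0.
    have c'S j1 g1 : (j1 < size l)%N -> tr c' j1 g1.+1 = 0.
      move=> lt_j1; have := sh0 j1 g1 lt_j1; rewrite {1}/tr; case: ifP => // ge_g1 _.
      by rewrite /tr; case: ifP => // /ltnW; rewrite ge_g1.
    case: g => [|g]; last exact: c'S.
    have := @radical_free _ _ _ data_b (tr c') _ j 0%N lt_j.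
    have /andP[lj_gt0 _] := l_bnd (mem_nth 0%N lt_j); move=> /(_ _ lj_gt0); apply.
    have eq0 (l1 : seq nat) b1 : size l1 = size l -> {in l1, forall i, 0 < i}%N ->
        combo l1 b1 (tr c') = \prod_(j < size l) b1 j 0%N ^+ tr c' j 0%N.
      move=> sz1 pos1; rewrite /combo sz1; apply: eq_bigr => j1 _.
      have : (0 < nth 0%N l1 j1)%N by rewrite pos1 ?mem_nth ?sz1.
      case: (nth 0%N l1 j1) => // m _; rewrite big_ord_recl big1 ?mulr1 // => g _.
      by rewrite c'S.
    rewrite eq0 //; last by move=> i /l_bnd/andP[].
    move: c'b'; rewrite eq0 //; last by move=> _ /mapP[i _ ->].
    apply: eq_pow_trans; apply: eq_pow_prod => j1 _.
    by apply/eq_powX/eq_pow_sym/Db'0.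
  move=> j g; rewrite size_l' => lt_j lt_g.
  have := zero (\max_(j < size l) nth 0%N l' j) c; rewrite tr_combo => /(_ cb').
  move=> zc; have := zc _ j g lt_j; rewrite /tr lt_g; apply.
  move=> j1 g1 lt_j1 le_g1; rewrite /tr ltnNge (leq_trans _ le_g1) //.
  exact: (leq_bigmax (Ordinal lt_j1)).
move=> j; rewrite size_l' => lt_j; have [_ _] := yP j lt_j.
by rewrite /= /b' lt_j subnn diff0.
Qed.

End RadicalData.

(** * Kummer theory over a split extension *)

Section SplitRealization.

Variables (p : nat) (gT : finGroupType) (sigma : gT) (m : nat).
Variable A : mx_representation 'F_p <[sigma]>%G m.

(* 'Gal({:L} / 1) is the semidirect product of the normal subgroup a('rV_m)   *)
(* and <[t]>, with t acting as sigma.                                         *)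
Record split_gal (F : fieldType) (L : splittingFieldType F)
    (t : gal_of {:L}) (a : 'rV['F_p]_m -> gal_of {:L}) : Prop := SplitGal {
  split_inj : injective a;
  split_add : forall u v, a (u + v) = (a u * a v)%g;
  split_act : forall u, (a u ^ t)%g = a (u *m A sigma);
  split_gen : forall x, exists i u, x = (t ^+ i * a u)%g;
  split_tri : forall i u, (t ^+ i)%g = a u -> (#[sigma]%g %| i)%N;
  split_ord : #[t]%g = #[sigma]%g
}.

Lemma mem_gal_full (F : fieldType) (L : splittingFieldType F) (x : gal_of {:L}) :
  x \in 'Gal({:L} / 1)%g.
Proof. by rewrite gal_kHom ?sub1v // k1AHom. Qed.

Local Notation to := ('MR A)%gact.

Lemma realizes_split_gal (F : fieldType) : realizes F (modsdprod A) ->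
  exists (L : splittingFieldType F) t a, galois 1 {:L} /\ @split_gal F L t a.
Proof.
case=> L [galL]; rewrite isog_sym => /isogP[f injf imf].
exists L, (f (sdpair2 to sigma)), (fun u => f (sdpair1 to u)); split=> //.
have fM x y : f (x * y)%g = (f x * f y)%g by rewrite morphM ?inE.
have finj : injective f by move=> x y /(injmP injf); apply; rewrite inE.
have fX x i : f (x ^+ i)%g = (f x ^+ i)%g by rewrite morphX ?inE.
have s_s : sigma \in <[sigma]>%g by apply: cycle_id.
have inj2 i u : (sdpair2 to sigma ^+ i)%g = sdpair1 to u -> (#[sigma]%g %| i)%N.
  rewrite -morphX //= => e.
  have : sdpair2 to (sigma ^+ i)%g \in (sdpair1 to @* [set: 'rV['F_p]_m] :&: sdpair2 to @* <[sigma]>)%g.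
    by rewrite inE {1}e !mem_morphim ?inE ?mem_cycle.
  rewrite im_sdpair_TI => /set1P e1; rewrite order_dvdn; apply/eqP.
  by apply: (injmP (injm_sdpair2 to)); rewrite ?mem_cycle ?group1 ?morph1.
split.
- by move=> u v /finj/(injmP (injm_sdpair1 to)); apply; rewrite inE.
- by move=> u v; rewrite -fM -morphM ?inE.
- move=> u; rewrite -[LHS](morphJ f) ?inE // -sdpair_act ?inE //.
  by rewrite /= mx_repr_actE.
- move=> x; have : x \in (f @* [set: sdprod_by to])%g by rewrite imf mem_gal_full.
  case/morphimP=> y _ _ ->; have := sdpairE y.
  case: y => [[c u] cu] /= yE; case/setXP: (cu) => /= /cycleP[i ci] _.
  by exists i, u; rewrite {1}yE fM /= ci morphX //= fX.
- by move=> i u; rewrite -fX => /finj/inj2.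
- by rewrite order_injm ?inE // order_injm ?injm_sdpair2.
Qed.

Lemma split_gal_realizes (F : fieldType) (L : splittingFieldType F) t a :
  galois 1 {:L} -> @split_gal F L t a -> realizes F (modsdprod A).
Proof.
move=> galL [a_inj aD a_act a_gen a_tri ord_t]; exists L; split=> //.
have aM : {in [set: 'rV['F_p]_m] &, {morph a : u v / (u * v)%g >-> (u * v)%g}}.
  by move=> u v _ _; rewrite FinRing.zmodMgE aD.
pose fH := Morphism aM.
have dvd_t : (#[t]%g %| #[sigma]%g)%N by rewrite ord_t.
pose fK := eltm_morphism dvd_t.
have actX u i : (a u ^ (t ^+ i))%g = a (u *m A (sigma ^+ i)%g).
  elim: i => [|i IHi]; first by rewrite conjg1 repr_mx1 mulmx1.
  rewrite expgSr conjgM IHi a_act -mulmxA expgSr repr_mxM ?mem_cycle ?cycle_id //.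
have actf : {in [set: 'rV['F_p]_m] & <[sigma]>%g, morph_act to 'J fH fK}.
  move=> u _ _ /cycleP[i ->] /=; rewrite mx_repr_actE ?mem_cycle //.
  by rewrite (eltmE dvd_t) actX.
rewrite isog_sym; apply/isogP; exists [morphism of xsdprodm actf].
  rewrite injm_xsdprodm; apply/and3P; split.
  - by apply/injmP => u v _ _; apply: a_inj.
  - by rewrite injm_eltm ord_t.
  - apply/eqP/trivgP/subsetP => x /setIP[/morphimP[u _ _ ->]].
    case/morphimP=> _ _ /cycleP[i ->]; rewrite /= (eltmE dvd_t) => e.
    have := a_tri i u (esym e); rewrite -ord_t order_dvdn => /eqP ti.
    by rewrite e ti group1.
rewrite im_xsdprodm; apply/eqP; rewrite eqEsubset; apply/andP; split.
  by apply/subsetP=> x _; apply: mem_gal_full.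
apply/subsetP=> x _; have [i [u xE]] := a_gen x.
have -> : x = (a u ^ (t ^+ i)^-1 * t ^+ i)%g by rewrite xE conjgE invgK -!mulgA mulVg mulg1.
have [j tj] : exists j, ((t ^+ i)^-1 = t ^+ j)%g.
  by apply/cycleP; rewrite groupV mem_cycle.
rewrite tj actX; apply: mem_mulg; first by rewrite (mem_morphim fH) ?inE.
by rewrite -(eltmE dvd_t) mem_morphim ?mem_cycle.
Qed.

End SplitRealization.

(** * Normal subfields as extensions in their own right, and roots of unity *)

Section SubfieldTypes.

Variable F : fieldType.

Lemma subfield_splittingFieldType (L : splittingFieldType F) (E : {subfield L}) :
    normalField 1 E ->
  exists (K : splittingFieldType F) (i : 'AHom(K, L)), limg i = E.
Proof.
case/(splitting_normalField (sub1v E)) => P /polyOver1P[P0 P0E] [rs Prs rsE].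
pose toL := linfun (vsval : subvs_of E -> L).
have [ys ysE] : exists ys, map toL ys = rs.
  exists (map (vsproj E) rs); rewrite -map_comp map_id_in // => y rs_y.
  by rewrite /= lfunE /= vsprojK // -rsE seqv_sub_adjoin.
have split_E : SplittingField.axiom (subvs_of E).
  exists (map_poly (in_alg (subvs_of E)) P0); first by apply/polyOver1P; exists P0.
  exists ys.
    set lhs := (lhs in lhs %= _); set rhs := (rhs in _ %= rhs).
    suffices: map_poly toL lhs %= map_poly toL rhs by rewrite eqp_map.
    rewrite -ysE big_map P0E in Prs; apply: etrans Prs; apply: congr2.
      by rewrite -map_poly_comp; apply/eq_map_poly=> x; apply: rmorph_alg.
    rewrite rmorph_prod; apply/eq_bigr=> x _.
    by rewrite rmorphB /= map_polyX map_polyC.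
  set Lzs := LHS; pose Lys := (toL @: Lzs)%VS; apply/vspaceP=> u.
  have: val u \in Lys by rewrite /Lys aimg_adjoin_seq aimg1 ysE rsE (valP u).
  by case/memv_imgP=> v Lzs_v; rewrite memvf lfunE => /val_inj->.
pose mix := FieldExt_isSplittingField.Build F (subvs_of E) split_E.
pose K : splittingFieldType F := HB.pack (subvs_of E) mix.
exists K, toL; apply/vspaceP=> u; apply/memv_imgP/idP => [[v _ ->] | Eu].
  by rewrite lfunE subvsP.
by exists (vsproj E u); rewrite ?memvf // lfunE /= vsprojK.
Qed.

Lemma restrict_gal (K L : splittingFieldType F) (i : 'AHom(K, L)) (x : gal_of {:L}) :
    (x @: limg i <= limg i)%VS ->
  exists s : gal_of {:K}, forall e, i (s e) = x (i e).
Proof.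
move=> xE; pose f := (i^-1 \o (x \o i))%VF : 'End(K).
have fE e : i (f e) = x (i e).
  rewrite !comp_lfunE limg_lfunVK //; apply: (subvP xE).
  by rewrite memv_img ?memv_img ?memvf.
have i_inj : injective i by apply: fmorph_inj.
have kf : kAut 1 {:K} f.
  rewrite kAutfE; apply/kHomP_tmp; split=> [_ /vlineP[c ->] | u v _ _]; apply: i_inj.
    by apply: etrans (fE _) _; rewrite !rmorph_alg.
  by apply: etrans (fE _) _; rewrite !rmorphM /= -!fE.
have [s _ sE] := kAut_to_gal kf.
by exists s => e; rewrite -sE ?memvf.
Qed.

End SubfieldTypes.

Section Zeta.

Variables (p : nat) (F : fieldType) (z : F) (L : splittingFieldType F).
Hypotheses (p_pr : prime p) (prim_z : p.-primitive_root z).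
Local Notation zL := (z%:A : L).
Implicit Types a b : 'F_p.

Lemma prim_zA : p.-primitive_root zL.
Proof. by rewrite (fmorph_primitive_root (in_alg L)). Qed.

Lemma zA_neq0 : zL != 0.
Proof. by rewrite (prim_root_eq0 prim_zA) -lt0n prime_gt0. Qed.

Lemma zAD a b : zL ^+ (a + b)%R = zL ^+ a * zL ^+ b.
Proof.
rewrite -exprD -[RHS](prim_expr_mod prim_zA) /=.
by rewrite [in X in (_ %% X)%N](Fp_cast p_pr).
Qed.

Lemma zAM a (i : nat) : zL ^+ (a *+ i)%R = (zL ^+ a) ^+ i.
Proof. by elim: i => [|i IHi]; rewrite ?expr0 // mulrS zAD IHi exprS. Qed.

Lemma zA_sum (I : Type) (r : seq I) (f : I -> 'F_p) :
  zL ^+ (\sum_(i <- r) f i)%R = \prod_(i <- r) zL ^+ f i.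
Proof.
by elim: r => [|i r IHr]; rewrite ?big_nil ?expr0 // !big_cons zAD IHr.
Qed.

Lemma zA_inj a b : zL ^+ a = zL ^+ b -> a = b.
Proof.
move/eqP; rewrite (eq_prim_root_expr prim_zA) => /eqP.
have lt_p (e : 'F_p) : (e < p)%N by rewrite -[X in (_ < X)%N](Fp_cast p_pr).
by rewrite !modn_small // => /val_inj.
Qed.

Lemma gal_zA (x : gal_of {:L}) (i : nat) : x (zL ^+ i) = zL ^+ i.
Proof. by rewrite rmorphXn /= rmorph_alg. Qed.

Lemma pth_root_eq (u v : L) : v != 0 -> u ^+ p = v ^+ p ->
  exists i : 'F_p, u = zL ^+ i * v.
Proof.
move=> nzv uv; have /(prim_rootP prim_zA)[i uE] : (u / v) ^+ p = 1.
  by rewrite expr_div_n uv divff ?expf_neq0.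
exists (i%:R); rewrite val_Fp_nat // modn_small //.
by rewrite -uE divfK.
Qed.

End Zeta.

(** * From a split extension to strings of power classes *)

Section Kummer.

Variables (p n : nat) (F : fieldType) (z : F).
Hypotheses (p_pr : prime p) (prim_z : p.-primitive_root z).
Variables (gT : finGroupType) (sigma : gT) (m : nat).
Variable A : mx_representation 'F_p <[sigma]>%G m.
Hypothesis ord_sigma : #[sigma]%g = (p ^ n)%N.
Variables (L : splittingFieldType F) (t : gal_of {:L}).
Variable a : 'rV['F_p]_m -> gal_of {:L}.
Hypotheses (galL : galois 1 {:L}) (split_a : split_gal A t a).
Local Notation zL := (z%:A : L).

(** A Lagrange resolvent, the sum of z^(- k u) * a u c; independence of automorphisms provides a c
    for which it is nonzero. *)
Lemma kummer_eigen (k : 'rV['F_p]_m -> 'F_p) :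
    (forall u v, k (u + v) = k u + k v) ->
  exists2 b : L, b != 0 & forall u, a u b = zL ^+ k u * b.
Proof.
move=> kD; have [a_inj aD _ _ _ _] := split_a.
have k0 : k 0 = 0 by apply: (addrI (k 0)); rewrite -kD !addr0.
have kN u : k (- u) = - k u by apply: (addrI (k u)); rewrite -kD !subrr.
have [w [w0 wB wx]] : exists w : 'rV['F_p]_m -> L,
    [/\ w 0 = 1, forall u v, w (u - v) = zL ^+ k v * w u & forall (x : gal_of {:L}) u, x (w u) = w u].
  exists (fun u => zL ^+ (- k u)%R); split=> [|u v|x u]; last exact: gal_zA.
    by rewrite k0 oppr0 expr0.
  by rewrite kD kN opprD opprK addrC zAD.
pose c_ y := \sum_(u | a u == y) w u.
have [|c _] := @gal_independent_contra F L _ xpredT c_ (a 0) isT.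
  rewrite /c_ (big_pred1 0) => [|u]; last by rewrite /= (inj_eq a_inj).
  by rewrite w0 oner_neq0.
have -> : \sum_y c_ y * y c = \sum_u w u * a u c.
  rewrite [RHS](partition_big a xpredT) //=; apply: eq_bigr => y _.
  by rewrite mulr_suml; apply: eq_bigr => u /eqP->.
set b := \sum_u _ => nzb; exists b => // v.
rewrite rmorph_sum /= mulr_sumr (reindex_inj (addIr (- v))) /=.
apply: eq_bigr => u _; rewrite rmorphM /= wx wB mulrA; congr (_ * _).
by rewrite -galM_full -aD subrK.
Qed.

Lemma galois_fixed1 (e : L) : (forall x : gal_of {:L}, x e = e) -> e \in 1%VS.
Proof.
move=> xe; rewrite -(galois_fixedField galL).
by apply/fixedFieldP; rewrite ?memvf.
Qed.

(** K is the fixed field of the image of [a], and [b j g] is the p-th power of an eigenvector with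
    character u |-> [k u j g]. The automorphism s is the restriction of the inverse of t: it turns a
    character k into u |-> k (u *m A sigma), so the relations of [jcoord] become those of the
    strings. *)
Lemma kummer_radical_data (l : seq nat) k : jcoord (A sigma) l k ->
  exists (K : splittingFieldType F) (s : gal_of {:K}) b,
    [/\ #[s]%g = (p ^ n)%N, forall e, s e = e -> e \in 1%VS & radical_data p n s l b].
Proof.
move=> [kD kI kS kZ kA]; have [a_inj aD a_act a_gen a_tri ord_t] := split_a.
have aM : {in [set: 'rV['F_p]_m] &, {morph a : u v / (u * v)%g >-> (u * v)%g}}.
  by move=> u v _ _; rewrite FinRing.zmodMgE aD.
pose N := (Morphism aM @* [set: 'rV['F_p]_m])%G.
have NP x : reflect (exists u, x = a u) (x \in N).
  apply: (iffP morphimP) => [[u _ _ ->] | [u ->]]; first by exists u.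
  by exists u; rewrite ?inE.
have a_t u e : a u (t^-1%g e) = t^-1%g (a (u *m A sigma) e).
  rewrite -!galM_full -a_act; congr (gal_repr _ _).
  by rewrite conjgE -!mulgA mulgV mulg1.
pose E := fixedField N.
have EP e : reflect (forall u, a u e = e) (e \in E).
  apply: (iffP (fixedFieldP (memvf e))) => [fe u | fe x /NP[u ->] //].
  by apply: fe; apply/NP; exists u.
have nN : (N <| 'Gal({:L} / 1))%g.
  apply/andP; split; first by apply/subsetP=> x _; apply: mem_gal_full.
  have nt : t \in 'N(N)%g.
    rewrite inE; apply/subsetP=> _ /imsetP[x /NP[u ->] ->].
    by rewrite a_act; apply/NP; exists (u *m A sigma).
  apply/subsetP=> x _; have [i [u ->]] := a_gen x.
  rewrite groupM ?groupX //; apply: (subsetP (normG N)).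
  by apply/NP; exists u.
have nE : normalField 1 E.
  by have /and3P[] := normal_fixedField_galois galL nN.
have [K [i imi]] := subfield_splittingFieldType nE.
have {}imi : limg i = E := imi.
have i_inj : injective i by apply: fmorph_inj.
have i_eq0 e : (i e == 0) = (e == 0) by apply: fmorph_eq0.
have iE e : i e \in E by rewrite -imi memv_img ?memvf.
have iP e : e \in E -> exists e', e = i e'.
  by rewrite -imi => /memv_imgP[e' _ ->]; exists e'.
have tE : (t^-1%g @: limg i <= limg i)%VS.
  rewrite imi; apply/subvP=> _ /memv_imgP[e /EP Ee ->].
  by apply/EP => u; rewrite a_t Ee.
have [s sE] := restrict_gal tE.
have sX j e : i ((s ^+ j)%g e) = ((t^-1) ^+ j)%g (i e).
  by elim: j => [|j IHj]; rewrite ?gal_id // !galXS sE IHj.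
have ord_s : #[s]%g = (p ^ n)%N.
  apply/eqP; rewrite -ord_sigma eqn_dvd; apply/andP; split.
    rewrite order_dvdn; apply/eqP/eqP/gal_eqP => e _; apply: i_inj.
    by rewrite sX gal_id expgVn -ord_t expg_order invg1 gal_id.
  set j := #[s]%g; have tjN : ((t^-1) ^+ j)%g \in N.
    rewrite -(gal_fixedField N) gal_kHom ?fixedField_bound //.
    apply/kAHomP => e; rewrite -/E => /iP[e' ->].
    by rewrite -sX expg_order gal_id.
  move: tjN; rewrite expgVn groupV => /NP[u]; exact: a_tri.
have fix_s e : s e = e -> e \in 1%VS.
  move=> se; have te : t^-1%g (i e) = i e by rewrite -sE se.
  have : i e \in 1%VS.
    apply: galois_fixed1 => x; have [j [u ->]] := a_gen x.
    have -> : (t ^+ j = (t^-1) ^- j)%g by rewrite expgVn invgK.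
    have tje : ((t^-1) ^- j)%g (i e) = i e.
      by rewrite -{1}(gal_fixX j te) -galM_full mulgV gal_id.
    by rewrite galM_full tje; apply/EP.
  case/vlineP=> c; rewrite -[c%:A](rmorph_alg i) => /i_inj->.
  exact/vlineP/(ex_intro _ c).
have [b0 b0P] : exists b0 : nat -> nat -> L,
    forall j g, b0 j g != 0 /\ forall u, a u (b0 j g) = zL ^+ k u j g * b0 j g.
  have bex j g : exists b : L, (b != 0) && [forall u, a u b == zL ^+ k u j g * b].
    have [|b nzb bE] := @kummer_eigen (fun u => k u j g); first by [].
    by exists b; rewrite nzb; apply/forallP=> u; apply/eqP.
  exists (fun j g => xchoose (bex j g)) => j g.
  have /andP[nzb /forallP bE] := xchooseP (bex j g).
  by split=> // u; apply/eqP.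
have nzb0 j g : b0 j g != 0 by have [] := b0P j g.
have ab0 u j g : a u (b0 j g) = zL ^+ k u j g * b0 j g by have [] := b0P j g.
have nzz : zL != 0 := zA_neq0 L p_pr prim_z.
have zp (c : 'F_p) : (zL ^+ c) ^+ p = 1.
  by rewrite -exprM mulnC exprM (prim_expr_order (prim_zA L prim_z)) expr1n.
have [b bE] : exists b : nat -> nat -> K, forall j g, i (b j g) = b0 j g ^+ p.
  have bex j g : exists e, i e == b0 j g ^+ p.
    have /iP[e ->] : b0 j g ^+ p \in E; last by exists e.
    by apply/EP => u; rewrite rmorphXn /= ab0 exprMn zp mul1r.
  by exists (fun j g => xchoose (bex j g)) => j g; apply/eqP/(xchooseP (bex j g)).
have powE (x y : K) (w : L) : w != 0 -> (forall u, a u w = w) -> i x = i y * w ^+ p ->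
    eq_pow p x y.
  move=> nzw fw xE; have /iP[w' wE] : w \in E by apply/EP.
  exists w'; first by rewrite wE fmorph_eq0 in nzw.
  by apply: i_inj; apply: etrans xE _; rewrite rmorphM rmorphXn wE.
have at0 u j g : a u (t^-1%g (b0 j g)) = zL ^+ k (u *m A sigma) j g * t^-1%g (b0 j g).
  by rewrite a_t ab0 rmorphM /= gal_zA.
exists K, s, b; split=> //; split.
- by move=> j g; rewrite -i_eq0 bE expf_neq0.
- move=> j lt_j; apply: (powE _ _ (t^-1%g (b0 j 0%N) / b0 j 0%N)).
  + by rewrite mulf_neq0 ?invr_eq0 ?gal_neq0.
  + move=> u; rewrite rmorphM fmorphV /= at0 ab0 kZ //.
    by rewrite invfM mulrACA divff ?mul1r // expf_neq0.
  + by rewrite sE !bE rmorphXn /= expr_div_n mulrCA divff ?mulr1 ?expf_neq0.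
- move=> j g lt_j lt_g; set b1 := b0 j g.+1; set b2 := b0 j g.
  apply: (powE _ _ (t^-1%g b1 / (b1 * b2))).
  + by rewrite mulf_neq0 ?gal_neq0 ?invr_eq0 ?mulf_neq0 ?nzb0.
  + move=> u; rewrite rmorphM fmorphV rmorphM /= at0 !ab0 kA //.
    rewrite zAD // -/b1 -/b2 mulrACA invfM mulrACA divff ?mul1r //.
    by rewrite mulf_neq0 ?expf_neq0.
  + rewrite sE rmorphM /= !bE rmorphXn /= -/b1 -/b2 -!exprMn mulrCA.
    by rewrite divff ?mulr1 // mulf_neq0 ?nzb0.
(* A relation makes B, the product of the eigenvectors, a root of unity times an element of E, hence
   fixed by every [a u]. The pairing of c with all coordinate vectors is then 0, and vectors with a
   single nonzero coordinate isolate each c j g. *)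
- move=> c [w nzw cE].
  have aB u : a u (\prod_(j < size l) \prod_(g < nth 0%N l j) b0 j g ^+ c j g)
      = zL ^+ (\sum_(j < size l) \sum_(g < nth 0%N l j) (k u j g * c j g))%R *
        \prod_(j < size l) \prod_(g < nth 0%N l j) b0 j g ^+ c j g.
    have kcE j g : zL ^+ (k u j g * c j g)%R = (zL ^+ k u j g) ^+ c j g.
      have -> : k u j g * c j g = k u j g *+ c j g by rewrite -mulr_natr natr_Zp.
      by rewrite zAM.
    have -> : zL ^+ (\sum_(j < size l) \sum_(g < nth 0%N l j) (k u j g * c j g))%R =
        \prod_(j < size l) \prod_(g < nth 0%N l j) (zL ^+ k u j g) ^+ c j g.
      rewrite zA_sum //; apply: eq_bigr => j _.
      by rewrite zA_sum //; apply: eq_bigr => g _; apply: kcE.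
    rewrite -big_split rmorph_prod; apply: eq_bigr => j _ /=.
    rewrite -big_split rmorph_prod; apply: eq_bigr => g _ /=.
    by rewrite rmorphXn /= ab0 exprMn.
  set B := \prod_(j < size l) _ in aB.
  have nzB : B != 0.
    by apply/prodf_neq0=> j _; apply/prodf_neq0=> g _; rewrite expf_neq0.
  have Bp : B ^+ p = i w ^+ p.
    rewrite -rmorphXn -[w ^+ p]mul1r -cE /combo rmorph_prod -prodrXl.
    apply: eq_bigr => j _ /=; rewrite rmorph_prod -prodrXl; apply: eq_bigr => g _ /=.
    by rewrite rmorphXn /= bE -!exprM mulnC.
  have [|d BE] := pth_root_eq p_pr prim_z _ Bp; first by rewrite i_eq0.
  have sum0 u : \sum_(j < size l) \sum_(g < nth 0%N l j) (k u j g * c j g) = 0.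
    have := aB u; set S := (\sum_(j < _) _)%R => aBS.
    suff /(zA_inj p_pr prim_z) : zL ^+ S = zL ^+ (0 : 'F_p)%R by [].
    rewrite expr0; apply: (mulIf nzB); rewrite -aBS mul1r BE rmorphM /= gal_zA; congr (_ * _).
    exact: (elimT (EP _)).
  move=> j g lt_j lt_g.
  have [u uE] := kS (fun j' g' => ((j' == j) && (g' == g))%:R).
  have := sum0 u; rewrite (bigD1 (Ordinal lt_j)) //= (bigD1 (Ordinal lt_g)) //=.
  rewrite uE // !eqxx mul1r !big1 ?addr0 //.
  + move=> j'; rewrite -val_eqE /= => /negPf neq; rewrite big1 // => g' _.
    by rewrite uE // neq mul0r.
  + move=> g'; rewrite -val_eqE /= => /negPf neq.
    by rewrite uE // neq andbF mul0r.
move=> j lt_j; set y := nrm _ _ _ => /= [[w nzw]]; rewrite mul1r => yE.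
set b1 := b0 j (nth 0%N l j).-1.
(* The splitting enters here: t has order p^n, so C, a p-th root of y, is fixed by t. If y is a p-th
   power in K, then C lies in E and provides the fixed root. *)
pose C := nrm (t^-1)%g (p ^ n) b1.
have Cp : C ^+ p = i y.
  rewrite -nrmX /y /nrm rmorph_prod; apply: eq_bigr => j' _ /=.
  by rewrite sX bE.
have tC : t^-1%g C = C.
  apply: (mulIf (nzb0 j (nth 0%N l j).-1)); rewrite nrm_tele.
  have -> : ((t^-1) ^+ (p ^ n) = 1)%g.
    by rewrite expgVn -ord_sigma -ord_t expg_order invg1.
  by rewrite gal_id.
have [||d CE] := pth_root_eq p_pr prim_z (u := C) (v := i w).
- by rewrite i_eq0.
- by rewrite Cp yE rmorphXn.
have /iP[c cE] : C \in E.
  by apply/EP => u; rewrite CE rmorphM /= gal_zA (elimT (EP _)).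
exists c; apply: i_inj; first by rewrite sE -cE tC.
by rewrite -Cp cE rmorphXn.
Qed.

End Kummer.

(** * Radical extensions with prescribed module *)

Section SplittingFields.

Lemma base_adjoin (F : fieldType) (K : fieldExtType F) (L : fieldExtType K)
    (ys : seq L) : <<1 & ys>>%VS = {:L}%VS ->
  exists2 i : 'AHom(K, baseFieldType L), forall e, i e = e%:A :> L
    & <<limg i & (ys : seq (baseFieldType L))>>%VS = {:baseFieldType L}%VS.
Proof.
move=> ys_gen; pose L0 := baseFieldType L; pose f (e : K) : L0 := (e%:A : L).
have f_lin : linear f.
  move=> c u v; rewrite /f scalerDl baseField_scaleE scalerA; congr (_ + _).
  by rewrite mulr_algl.
pose fL := GRing.isLinear.Build F K L0 *:%R f f_lin.
pose fl : {linear K -> L0} := HB.pack f fL.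
have fE e : linfun fl e = e%:A :> L by rewrite lfunE.
have f_hom : ahom_in {:K} (linfun fl).
  apply/ahomP_tmp; split; first by apply: etrans (fE _) _; rewrite scale1r.
  move=> u v; apply: etrans (fE _) _.
  have -> : (linfun fl u * linfun fl v : L) = u%:A * v%:A :> L by rewrite !fE.
  exact: (rmorphM (in_alg L)).
pose i := AHom f_hom; exists i => //.
pose V := <<limg i & (ys : seq L0)>>%AS.
have sub_V : (refBaseField L <= V)%VS.
  apply/subvP=> e; rewrite refBaseField.unlock mem_baseVspace => /vlineP[c ->].
  apply: (subvP (subv_adjoin_seq _ _)); apply/memv_imgP; exists c; first exact: memvf.
  exact: esym (fE c).
have [E VE memE] := module_baseAspace sub_V.
have EL : (E : {vspace L}) = {:L}%VS.
  apply/eqP; rewrite eqEsubv subvf -ys_gen; apply/Fadjoin_seqP; split.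
    exact: sub1v.
  by move=> y ys_y; rewrite -memE seqv_sub_adjoin.
apply/eqP; rewrite eqEsubv subvf; apply/subvP=> e _.
by move: (@memvf K L e); rewrite -EL -memE.
Qed.

Lemma irreducible_factor (K : fieldType) (P : {poly K}) : (1 < size P)%N ->
  exists2 r, r %| P & irreducible_poly r.
Proof.
have [n] := ubnP (size P); elim: n P => // n IHn P lt_n P_gt1.
(* Irreducibility over an abstract field is not decidable. *)
case: (classic (irreducible_poly P)) => [irrP | redP]; first by exists P.
have [q q_dvd [q_neq1 q_neqP]] : exists2 q, q %| P & size q != 1%N /\ ~~ (q %= P).
  apply: NNPP => noq; apply: redP; split=> // q q1 qP; apply/negPn/negP => qnP.
  by apply: noq; exists q.
have nzP : P != 0 by rewrite -size_poly_gt0 ltnW.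
have q_gt1 : (1 < size q)%N.
  by rewrite ltn_neqAle eq_sym q_neq1 size_poly_gt0 (dvdpN0 q_dvd).
have q_lt : (size q < size P)%N.
  by rewrite ltn_neqAle dvdp_leq // andbT; apply: contra q_neqP; rewrite dvdp_size_eqp.
have [|r r_q irr_r] := IHn q _ q_gt1; first exact: leq_trans q_lt lt_n.
by exists r => //; apply: dvdp_trans r_q q_dvd.
Qed.

Lemma splitting_field_exists (K : fieldType) (P : {poly K}) : P != 0 ->
  exists (L : fieldExtType K) (ys : seq L),
    map_poly (in_alg L) P %= \prod_(y <- ys) ('X - y%:P) /\ <<1 & ys>>%VS = {:L}%VS.
Proof.
have [n] := ubnP (size P); elim: n => // n IHn in K P * => lt_n nzP.
have [P_le1 | P_gt1] := leqP (size P) 1.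
  exists K^o, [::]; rewrite big_nil Fadjoin_nil regular_fullv; split=> //.
  by rewrite -size_poly_eq1 size_map_poly eqn_leq P_le1 size_poly_gt0.
have [r r_dvd irr_r] := irreducible_factor P_gt1.
have [K1 _ [x rx x_gen]] := irredp_FAdjoin irr_r.
have /factor_theorem[q PE] : root (map_poly (in_alg K1) P) x.
  by rewrite -(divpK r_dvd) rmorphM rootM rx orbT.
have szP : size P = size (q * ('X - x%:P)) by rewrite -PE size_map_poly.
have nzq : q != 0.
  by move: nzP; rewrite -size_poly_eq0 szP size_poly_eq0 mulf_eq0 => /norP[].
have [|L [ys [qE ys_gen]]] := IHn K1 q _ nzq.
  by rewrite ltnS szP size_mul ?polyXsubC_eq0 ?size_XsubC ?addn2 in lt_n.
have [i iE i_gen] := base_adjoin ys_gen.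
exists (baseFieldType L), (i x :: (ys : seq (baseFieldType L))); split.
  have -> : map_poly (in_alg (baseFieldType L)) P = map_poly i (map_poly (in_alg K1) P).
    by rewrite -map_poly_comp; apply: eq_map_poly => c /=; rewrite rmorph_alg.
  rewrite PE rmorphM big_cons mulrC rmorphB /= map_polyX map_polyC.
  have -> : map_poly i q = map_poly (in_alg L) q by apply: eq_map_poly => c; rewrite /= iE.
  exact: eqp_mull.
rewrite adjoin_cons -i_gen; congr (<<_ & _>>%VS).
by rewrite -(aimg1 i) -aimg_adjoin x_gen.
Qed.

Lemma adjoin_cat (F : fieldType) (L : fieldExtType F) (K : {subfield L}) r1 r2 :
  <<K & r1 ++ r2>>%VS = <<<<K & r1>> & r2>>%VS.
Proof.
elim: r1 K => [|x r IHr] K; first by rewrite Fadjoin_nil.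
by rewrite !adjoin_cons IHr.
Qed.

(** The product of P with a polynomial over F split by K has coefficients in F, which makes the new
    field a splitting field over F itself. *)
Lemma adjoin_roots (F : fieldType) (K : splittingFieldType F) (P : {poly K}) :
    P != 0 -> P \is a polyOver 1%VS ->
  exists (L : splittingFieldType F) (i : 'AHom(K, L)) (ys : seq L),
    map_poly i P %= \prod_(y <- ys) ('X - y%:P) /\ <<limg i & ys>>%VS = {:L}%VS.
Proof.
move=> nzP P1; have [L [ys [PE ys_gen]]] := splitting_field_exists nzP.
have [i iE i_gen] := base_adjoin ys_gen.
have [Q Q1 [rs QE rs_gen]] := splittingPoly K.
have over1 (R : {poly K}) : R \is a polyOver 1%VS -> map_poly i R \is a polyOver 1%VS.
  case/polyOver1P=> R0 ->; apply/polyOver1P; exists R0.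
  by rewrite -map_poly_comp; apply: eq_map_poly => c /=; rewrite rmorph_alg.
have iP : map_poly i P = map_poly (in_alg L) P by apply: eq_map_poly => c; rewrite /= iE.
have split_L : SplittingField.axiom (baseFieldType L).
  exists (map_poly i (Q * P)); first by rewrite over1 // rpredM.
  exists (map i rs ++ (ys : seq (baseFieldType L))).
    rewrite big_cat rmorphM /= iP; apply: eqp_trans (eqp_mull _ PE).
    apply: eqp_mulr; have -> : \prod_(y <- map i rs) ('X - y%:P) = map_poly i (\prod_(y <- rs) ('X - y%:P)).
      rewrite big_map rmorph_prod; apply: eq_bigr => y _.
      by rewrite rmorphB /= map_polyX map_polyC.
    by have := QE; rewrite -(eqp_map i).
  have imi : limg i = <<1 & map i rs>>%VS by rewrite -rs_gen aimg_adjoin_seq aimg1.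
  by rewrite -i_gen imi; apply: (adjoin_cat 1%AS).
pose mix := FieldExt_isSplittingField.Build F (baseFieldType L) split_L.
pose L1 : splittingFieldType F := HB.pack (baseFieldType L) mix.
by exists L1, i, ys; split; rewrite ?iP.
Qed.

End SplittingFields.

Section RadicalPolynomial.

Variables (p n : nat) (F : fieldType) (K : splittingFieldType F).
Variables (s : gal_of {:K}) (l : seq nat) (b : nat -> nat -> K).
Hypotheses (p_gt0 : (0 < p)%N) (ord_s : #[s]%g = (p ^ n)%N).
Hypothesis fix_s : forall e, s e = e -> e \in 1%VS.

(** All s-conjugates of the radicands are included, so that s fixes the polynomial and its
    coefficients lie in F. *)
Definition radical_poly : {poly K} :=
  \prod_(x < p ^ n) \prod_(j < size l) \prod_(g < nth 0%N l j)
     ('X^p - ((s ^+ x)%g (b j g))%:P).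

Lemma radical_poly_neq0 : radical_poly != 0.
Proof.
apply/prodf_neq0=> x _; apply/prodf_neq0=> j _; apply/prodf_neq0=> g _.
exact/monic_neq0/monicXnsubC.
Qed.

Lemma radical_poly_over1 : radical_poly \is a polyOver 1%VS.
Proof.
apply/polyOverP=> e; apply: fix_s.
pose G x := \prod_(j < size l) \prod_(g < nth 0%N l j) ('X^p - ((s ^+ x)%g (b j g))%:P).
have sG x : map_poly s (G x) = G x.+1.
  rewrite rmorph_prod; apply: eq_bigr => j _; rewrite rmorph_prod.
  apply: eq_bigr => g _; rewrite rmorphB /= map_polyXn map_polyC /=.
  by rewrite galXS.
suff mP : map_poly s radical_poly = radical_poly by rewrite -[LHS]coef_map mP.
have -> : radical_poly = \prod_(x < p ^ n) G x by [].
rewrite rmorph_prod /=; under eq_bigr do rewrite sG.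
have pn_gt0 : (0 < p ^ n)%N by rewrite expn_gt0 p_gt0.
rewrite -(prednK pn_gt0) big_ord_recr [RHS]big_ord_recl mulrC /= prednK //.
congr (_ * _); rewrite /G; do 2!(apply: eq_bigr => ? _).
by rewrite -ord_s expg_order.
Qed.

End RadicalPolynomial.

(** * The Galois group of the radical extension *)

Section RadicalExtension.

Variables (p n : nat) (F : fieldType) (z : F).
Hypotheses (p_pr : prime p) (prim_z : p.-primitive_root z).
Variables (K : splittingFieldType F) (s : gal_of {:K}).
Variables (l : seq nat) (b : nat -> nat -> K).
Hypotheses (ord_s : #[s]%g = (p ^ n)%N).
Hypothesis fix_s : forall e, s e = e -> e \in 1%VS.
Hypothesis data_b : radical_data p n s l b.
Hypothesis l_bnd : {in l, forall i, 0 < i <= p ^ n}%N.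
Variables (L : splittingFieldType F) (i : 'AHom(K, L)) (ys : seq L).
Hypothesis ysP : map_poly i (radical_poly p n s l b) %= \prod_(y <- ys) ('X - y%:P).
Hypothesis ys_gen : <<limg i & ys>>%VS = {:L}%VS.

Local Notation zL := (z%:A : L).
Let E := (i @: {:K})%AS.
Let p_gt0 := prime_gt0 p_pr.
Let nzb := radical_neq0 data_b.

Lemma ext_inj : injective i.
Proof. exact: fmorph_inj. Qed.

Lemma ext_eq0 e : (i e == 0) = (e == 0).
Proof. exact: fmorph_eq0. Qed.

Lemma ext_mem e : i e \in E.
Proof. by rewrite memv_img ?memvf. Qed.

Lemma ext_memP e : e \in E -> exists e', e = i e'.
Proof. by case/memv_imgP=> e' _ ->; exists e'. Qed.

Lemma map_radical_poly : map_poly i (radical_poly p n s l b) =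
  \prod_(x < p ^ n) \prod_(j < size l) \prod_(g < nth 0%N l j)
     ('X^p - (i ((s ^+ x)%g (b j g)))%:P).
Proof.
do 3!(rewrite rmorph_prod; apply: eq_bigr => ? _).
by rewrite rmorphB /= map_polyXn map_polyC.
Qed.

Lemma radical_root y : y \in ys -> exists x j g,
  [/\ (j < size l)%N, (g < nth 0%N l j)%N & y ^+ p = i ((s ^+ x)%g (b j g))].
Proof.
rewrite -root_prod_XsubC -(eqp_root ysP) map_radical_poly.
rewrite rootE horner_prod => /prodf_eq0[x _]; rewrite horner_prod => /prodf_eq0[j _].
rewrite horner_prod => /prodf_eq0[g _]; rewrite !hornerE subr_eq0 => /eqP ye.
by exists x, j, g.
Qed.

Lemma radical_exists j g : (j < size l)%N -> (g < nth 0%N l j)%N ->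
  exists y, y ^+ p == i (b j g).
Proof.
move=> lt_j lt_g; have pn_gt0 : (0 < p ^ n)%N by rewrite expn_gt0 p_gt0.
have dvd_P : 'X^p - (i (b j g))%:P %| \prod_(y <- ys) ('X - y%:P).
  rewrite -(eqp_dvdr _ ysP) map_radical_poly (bigD1 (Ordinal pn_gt0)) //=.
  rewrite (bigD1 (Ordinal lt_j)) //= (bigD1 (Ordinal lt_g)) //= gal_id.
  by rewrite -!mulrA dvdp_mulr.
have [m mE] := dvdp_prod_XsubC dvd_P.
case: (mask m ys) mE => [|y r] mE.
  have := eqp_size mE; rewrite big_nil size_poly1 size_XnsubC //.
  by case: (p) p_gt0.
exists y; rewrite -subr_eq0.
have : root ('X^p - (i (b j g))%:P) y.
  by rewrite (eqp_root mE) root_prod_XsubC mem_head.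
by rewrite rootE !hornerE.
Qed.

Lemma ext_galois : galois E {:L}.
Proof.
rewrite /galois subvf normalFieldf andbT /=.
have -> : ({:L} = <<E & ys>>)%VS by rewrite -ys_gen.
apply: separable_Fadjoin_seq; apply/allP=> y /radical_root[x [j [g [_ _ ye]]]].
have nzy : y ^+ p != 0 by rewrite ye ext_eq0 gal_neq0.
apply/separable_elementP; exists ('X^p - (y ^+ p)%:P); split.
- by rewrite rpredB ?rpredX ?polyOverX ?polyOverC //= ye ext_mem.
- by rewrite rootE !hornerE subrr.
rewrite unlock; apply/Bezout_coprimepP; exists (p%:R, - 'X) => /=.
have nzp : p%:R != 0 :> L := prim_root_natf_neq0 (prim_zA L prim_z).
rewrite derivB derivXn derivC subr0 mulNr mulrnAr -exprS prednK //.
rewrite -['X^p *+ p]mulr_natl mulrBr addrAC subrr add0r -polyC_natr -polyCM -polyCN.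
by rewrite polyC_eqp1 oppr_eq0 mulf_neq0.
Qed.

Lemma ext_normal (x : gal_of {:L}) : (x @: limg i <= limg i)%VS.
Proof.
have [Q Q1 [rs QE rs_gen]] := splittingPoly K.
have nE : normalField 1 E.
  apply/(splitting_normalField (sub1v E)); exists (map_poly i Q).
    case/polyOver1P: Q1 => R0 ->; apply/polyOver1P; exists R0.
    by rewrite -map_poly_comp; apply: eq_map_poly => c /=; rewrite rmorph_alg.
  exists (map i rs).
    rewrite -(eqp_map i) rmorph_prod in QE; apply: eqp_trans QE _.
    rewrite big_map; under eq_bigr do rewrite rmorphB /= map_polyX map_polyC.
    exact: eqpxx.
  have imi : limg i = <<1 & map i rs>>%VS by rewrite -rs_gen aimg_adjoin_seq aimg1.
  exact: esym imi.
have /forall_inP/(_ x) := nE; rewrite inE kAutfE k1AHom => /(_ isT)/eqP->.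
exact: subvv.
Qed.

Lemma ext_lift : exists t : gal_of {:L}, forall e, t (i e) = i (s^-1%g e).
Proof.
pose f := (i \o (s^-1%g \o i^-1))%VF : 'End(L).
have iK e : (i^-1)%VF (i e) = e.
  by apply: ext_inj; rewrite limg_lfunVK // memv_img ?memvf.
have fE e : f (i e) = i (s^-1%g e) by rewrite !comp_lfunE iK.
have homf : kHom 1 E f.
  apply/kHomP_tmp; split=> [_ /vlineP[c ->] | _ _ /ext_memP[u ->] /ext_memP[v ->]].
    by rewrite -[c%:A](rmorph_alg i) fE; congr (i _); apply: rmorph_alg.
  by rewrite -[i u * i v](rmorphM i) fE [X in i X](rmorphM _) [LHS](rmorphM i) !fE.
have [||t _ tE] := @kHom_to_gal F L 1%AS E {:L}%AS f _ _ homf.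
- by rewrite sub1v subvf.
- exact: normalFieldf.
by exists t => e; rewrite -fE tE ?ext_mem.
Qed.

Variable bL : nat -> nat -> L.
Hypothesis bLp : forall j g, (j < size l)%N -> (g < nth 0%N l j)%N ->
  bL j g ^+ p = i (b j g).
Local Notation N := 'Gal({:L} / E)%g.
Implicit Types x y t : gal_of {:L}.

Lemma bL_neq0 j g : (j < size l)%N -> (g < nth 0%N l j)%N -> bL j g != 0.
Proof.
move=> lt_j lt_g; have : bL j g ^+ p != 0 by rewrite bLp // ext_eq0.
by apply: contraNneq => ->; rewrite expr0n gtn_eqF.
Qed.

Lemma extNP x : reflect (forall e, x (i e) = i e) (x \in N).
Proof.
rewrite gal_kHom ?subvf //; apply: (iffP kAHomP) => [xE e | xE _ /ext_memP[e ->] //].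
by rewrite xE ?ext_mem.
Qed.

(** The Kummer character of x at [b j g]; the default 0 is not reached for x in N and indices in
    range. *)
Definition chi x j g : 'F_p := odflt 0 [pick c : 'F_p | x (bL j g) == zL ^+ c * bL j g].

Lemma chi_eq x j g (c : 'F_p) : (j < size l)%N -> (g < nth 0%N l j)%N ->
  x (bL j g) = zL ^+ c * bL j g -> chi x j g = c.
Proof.
move=> lt_j lt_g xc; rewrite /chi; case: pickP => [c' /eqP | /(_ c)]; last first.
  by rewrite xc eqxx.
by rewrite xc => /(mulIf (bL_neq0 lt_j lt_g))/(zA_inj p_pr prim_z).
Qed.

Lemma chiE x j g : x \in N -> (j < size l)%N -> (g < nth 0%N l j)%N ->
  x (bL j g) = zL ^+ chi x j g * bL j g.
Proof.
move=> /extNP xN lt_j lt_g.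
have [c xc] : exists c : 'F_p, x (bL j g) = zL ^+ c * bL j g.
  apply: pth_root_eq => //; first exact: bL_neq0.
  by rewrite -rmorphXn bLp // [LHS]xN.
by rewrite (chi_eq lt_j lt_g xc).
Qed.

Lemma chiM x y j g : x \in N -> y \in N -> (j < size l)%N -> (g < nth 0%N l j)%N ->
  chi (x * y)%g j g = chi x j g + chi y j g.
Proof.
move=> Nx Ny lt_j lt_g; apply: chi_eq => //.
by rewrite galM_full chiE // rmorphM /= gal_zA chiE // zAD // mulrA.
Qed.

Lemma chi1 j g : (j < size l)%N -> (g < nth 0%N l j)%N -> chi 1%g j g = 0.
Proof. by move=> lt_j lt_g; apply: chi_eq => //; rewrite gal_id expr0 mul1r. Qed.

Lemma chi_inj x : x \in N ->
    (forall j g, (j < size l)%N -> (g < nth 0%N l j)%N -> chi x j g = 0) ->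
  x = 1%g.
Proof.
move=> Nx chi0; have xN := elimT (extNP x) Nx.
have rad (y : nat) : forall j g, (j < size l)%N -> (g < nth 0%N l j)%N ->
    exists2 r, r ^+ p = i ((s ^+ y)%g (b j g)) & x r = r.
  elim: y => [|y IHy] j g lt_j lt_g.
    exists (bL j g); first by rewrite gal_id bLp.
    by rewrite chiE // chi0 // expr0 mul1r.
  have [r rp xr] := IHy j g lt_j lt_g.
  rewrite expgS galM_full; case: g => [|g] in lt_g r rp xr *.
    have [u _ ->] := radical_fix data_b lt_j.
    exists (r * i ((s ^+ y)%g u)); last by rewrite rmorphM /= xr xN.
    by rewrite exprMn rp -[RHS]/(i _) !rmorphM !rmorphXn.
  have [r' r'p xr'] := IHy j g lt_j (ltnW lt_g).
  have [u _ ->] := radical_next data_b lt_j lt_g.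
  exists (r * r' * i ((s ^+ y)%g u)); last by rewrite !rmorphM /= xr xr' xN.
  by rewrite !exprMn rp r'p !rmorphM !rmorphXn.
have xL : (<<E & ys>> <= fixedField [set x])%VS.
  apply/(@Fadjoin_seqP _ _ E _ (fixedField_aspace [set x])); split.
    apply/subvP=> _ /ext_memP[e ->]; apply/fixedFieldP; rewrite ?memvf //.
    by move=> _ /set1P->.
  move=> y /radical_root[c [j [g [lt_j lt_g ye]]]].
  have [r rp xr] := rad c j g lt_j lt_g.
  have nzr : r != 0.
    have : r ^+ p != 0 by rewrite rp ext_eq0 gal_neq0.
    by apply: contraNneq => ->; rewrite expr0n gtn_eqF.
  have [|d ->] := pth_root_eq p_pr prim_z nzr (u := y); first by rewrite ye rp.
  apply/fixedFieldP; rewrite ?memvf // => _ /set1P->.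
  by rewrite rmorphM /= gal_zA xr.
apply/eqP/gal_eqP=> e _; rewrite gal_id.
have : e \in fixedField [set x] by apply: (subvP xL); rewrite [<<_ & _>>%VS]ys_gen memvf.
by case/mem_fixedFieldP=> _; apply; apply: set11.
Qed.

Variables (gT : finGroupType) (sigma : gT) (m : nat).
Variable A : mx_representation 'F_p <[sigma]>%G m.
Hypothesis ord_sigma : #[sigma]%g = (p ^ n)%N.
Variable k : 'rV['F_p]_m -> nat -> nat -> 'F_p.
Hypothesis jk : jcoord (A sigma) l k.

Let kD : forall u v j h, k (u + v) j h = k u j h + k v j h.
Proof. by case: jk. Qed.

Lemma coord0 j h : k 0 j h = 0.
Proof. by apply: (addrI (k 0 j h)); rewrite -kD !addr0. Qed.

Lemma coordMn u c j h : k (u *+ c) j h = k u j h *+ c.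
Proof. by elim: c => [|c IHc]; rewrite ?mulr0n ?coord0 // !mulrS kD IHc. Qed.

Lemma coord_sum (I : Type) (r : seq I) (f : I -> 'rV['F_p]_m) j h :
  k (\sum_(x <- r) f x) j h = \sum_(x <- r) k (f x) j h.
Proof.
by elim: r => [|x r IHr]; rewrite ?big_nil ?coord0 // !big_cons kD IHr.
Qed.

Lemma coord_inj u v :
    (forall j h, (j < size l)%N -> (h < nth 0%N l j)%N -> k u j h = k v j h) ->
  u = v.
Proof.
have [_ kI _ _ _] := jk; move=> uv; apply/eqP; rewrite -subr_eq0; apply/eqP/kI.
move=> j h lt_j lt_h; apply: (addIr (k v j h)).
by rewrite -kD subrK add0r uv.
Qed.

(** Otherwise a nonzero linear form f vanishes on the coordinate vectors of N. Its coefficients are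
    exponents for which the product B of the [bL j g] is fixed by N, hence lies in E; so the
    corresponding product of the [b j g] is a p-th power in K, against independence. *)
Lemma chi_surj u : exists2 x, x \in N &
  forall j g, (j < size l)%N -> (g < nth 0%N l j)%N -> chi x j g = k u j g.
Proof.
have [_ kI kS _ _] := jk.
have wex x : exists w : 'rV['F_p]_m, [forall j : 'I_(size l),
    [forall g : 'I_(nth 0%N l j), k w j g == chi x j g]].
  have [w wE] := kS (chi x); exists w.
  by apply/forallP=> j; apply/forallP=> g; apply/eqP/wE.
pose w x := xchoose (wex x).
have wE x j g : (j < size l)%N -> (g < nth 0%N l j)%N -> k (w x) j g = chi x j g.
  move=> lt_j lt_g; have /forallP/(_ (Ordinal lt_j)) := xchooseP (wex x).
  by move/forallP/(_ (Ordinal lt_g))/eqP.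
pose M := \matrix_(r < #|N|) w (enum_val r).
have fullM : row_full M.
  rewrite -col_leq_rank leqNgt; apply/negP => lt_M.
  have [f nzf Mf] : exists2 f : 'cV['F_p]_m, f != 0 & M *m f = 0.
    have nzC : cokermx M != 0.
      by rewrite -mxrank_eq0 mxrank_coker -lt0n subn_gt0.
    have [c nzc] : exists c, col c (cokermx M) != 0.
      apply/existsP; apply: contraNT nzC => /existsPn col0.
      apply/eqP/matrixP=> r c; have := col0 c; rewrite negbK => /eqP/colP/(_ r).
      by rewrite !mxE.
    by exists (col c (cokermx M)) => //; rewrite colE mulmxA mulmx_coker mul0mx.
  have wf x : x \in N -> w x *m f = 0.
    move=> Nx; have := congr1 (row (enum_rank_in Nx x)) Mf.
    by rewrite row_mul rowK enum_rankK_in // row0.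
  have eex j g : exists e : 'rV['F_p]_m, [forall j' : 'I_(size l),
      [forall g' : 'I_(nth 0%N l j'), k e j' g' == ((j' == j :> nat) && (g' == g :> nat))%:R]].
    have [e eE] := kS (fun j' g' => ((j' == j) && (g' == g))%:R); exists e.
    by apply/forallP=> j'; apply/forallP=> g'; apply/eqP/eE.
  pose e j g := xchoose (eex j g).
  have eE j g j' g' : (j' < size l)%N -> (g' < nth 0%N l j')%N ->
      k (e j g) j' g' = ((j' == j) && (g' == g))%:R.
    move=> lt_j lt_g; have /forallP/(_ (Ordinal lt_j)) := xchooseP (eex j g).
    by move/forallP/(_ (Ordinal lt_g))/eqP.
  have decomp v : v = \sum_(j < size l) \sum_(g < nth 0%N l j) (e j g *+ k v j g).
    apply: coord_inj => j g lt_j lt_g; rewrite coord_sum.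
    rewrite (bigD1 (Ordinal lt_j)) //= coord_sum (bigD1 (Ordinal lt_g)) //=.
    rewrite coordMn eE // !eqxx natr_Zp !big1 ?addr0 //.
    - move=> j'; rewrite -val_eqE /= => neq; rewrite coord_sum big1 // => g' _.
      by rewrite coordMn eE // eq_sym (negPf neq) mul0rn.
    - move=> g'; rewrite -val_eqE /= => neq.
      by rewrite coordMn eE // [g == _]eq_sym (negPf neq) andbF mul0rn.
  pose c j g : 'F_p := (e j g *m f) 0 0.
  have fE v : (v *m f) 0 0 = \sum_(j < size l) \sum_(g < nth 0%N l j) (c j g *+ k v j g).
    rewrite {1}(decomp v) mulmx_suml summxE; apply: eq_bigr => j _.
    rewrite mulmx_suml summxE; apply: eq_bigr => g _.
    by rewrite -scaler_nat -scalemxAl mxE mulr_natl.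
  have c0 : forall j g, (j < size l)%N -> (g < nth 0%N l j)%N -> c j g = 0.
    apply: (radical_free data_b).
    pose B := \prod_(j < size l) \prod_(g < nth 0%N l j) bL j g ^+ c j g.
    have /ext_memP[e' BE] : B \in E.
      rewrite -(galois_fixedField ext_galois); apply/fixedFieldP; rewrite ?memvf // => x Nx.
      have xB : x B = zL ^+ ((w x *m f) 0 0)%R * B.
        have ze j g : (j < size l)%N -> (g < nth 0%N l j)%N ->
            zL ^+ (c j g *+ k (w x) j g)%R = (zL ^+ chi x j g) ^+ c j g.
          move=> lt_j lt_g; rewrite wE //; have -> : c j g *+ chi x j g = chi x j g *+ c j g.
            by rewrite -mulr_natr natr_Zp -[RHS]mulr_natr natr_Zp mulrC.
          by rewrite zAM.
        have -> : zL ^+ ((w x *m f) 0 0)%R =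
            \prod_(j < size l) \prod_(g < nth 0%N l j) (zL ^+ chi x j g) ^+ c j g.
          rewrite fE zA_sum //; apply: eq_bigr => j _.
          by rewrite zA_sum //; apply: eq_bigr => g _; apply: ze.
        rewrite -big_split rmorph_prod; apply: eq_bigr => j _ /=.
        rewrite -big_split rmorph_prod; apply: eq_bigr => g _ /=.
        by rewrite rmorphXn /= chiE // exprMn.
      by rewrite xB wf // mxE expr0 mul1r.
    have nzB : B != 0.
      apply/prodf_neq0=> j _; apply/prodf_neq0=> g _.
      by rewrite expf_neq0 // bL_neq0.
    exists e'; first by rewrite -ext_eq0 -BE.
    apply: ext_inj; rewrite mul1r rmorphXn -[RHS]/(i e' ^+ p) -BE -prodrXl rmorph_prod.
    apply: eq_bigr => j _; rewrite -prodrXl rmorph_prod; apply: eq_bigr => g _.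
    by rewrite rmorphXn /= -bLp // -!exprM mulnC.
  case/eqP: nzf; apply/colP=> r; rewrite [RHS]mxE.
  have -> : f r 0 = row r f 0 0 by rewrite mxE.
  rewrite rowE fE big1 // => j _; rewrite big1 // => g _.
  by rewrite c0 ?mul0rn.
have /submxP[v uE] : (u <= M)%MS by apply: submx_full.
exists (\prod_(r < #|N|) enum_val r ^+ (v 0 r : 'F_p))%g.
  by apply: group_prod => r _; rewrite groupX // enum_valP.
move=> j g lt_j lt_g.
have chi_prod (r : seq 'I_#|N|) :
    chi (\prod_(c <- r) enum_val c ^+ (v 0 c : 'F_p))%g j g =
      \sum_(c <- r) chi (enum_val c) j g *+ v 0 c.
  have chiX x c : x \in N -> chi (x ^+ c)%g j g = chi x j g *+ c.
    move=> Nx; elim: c => [|c IHc]; first by rewrite chi1.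
    by rewrite expgS chiM ?groupX // IHc mulrS.
  elim: r => [|c r IHr]; first by rewrite !big_nil chi1.
  rewrite !big_cons chiM ?groupX ?enum_valP //; last first.
    by apply: group_prod => ? _; rewrite groupX ?enum_valP.
  by rewrite IHr chiX ?enum_valP.
rewrite chi_prod uE mulmx_sum_row coord_sum; apply: eq_bigr => c _.
by rewrite rowK -[v 0 c in RHS]natr_Zp scaler_nat coordMn wE.
Qed.

Lemma kummer_iso : exists a : 'rV['F_p]_m -> gal_of {:L},
  [/\ forall u, a u \in N,
      forall u j g, (j < size l)%N -> (g < nth 0%N l j)%N -> chi (a u) j g = k u j g
    & forall x, x \in N -> exists u, x = a u].
Proof.
have aex u : exists x, (x \in N) && [forall j : 'I_(size l),
    [forall g : 'I_(nth 0%N l j), chi x j g == k u j g]].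
  have [x Nx xE] := chi_surj u; exists x; rewrite Nx.
  by apply/forallP=> j; apply/forallP=> g; apply/eqP/xE.
pose a u := xchoose (aex u).
have aE u j g : (j < size l)%N -> (g < nth 0%N l j)%N -> chi (a u) j g = k u j g.
  move=> lt_j lt_g; have /andP[_ /forallP/(_ (Ordinal lt_j))] := xchooseP (aex u).
  by move/forallP/(_ (Ordinal lt_g))/eqP.
have aN u : a u \in N by have /andP[] := xchooseP (aex u).
exists a; split=> // x Nx; have [_ _ kS _ _] := jk; have [u uE] := kS (chi x).
exists u; apply: (mulIg (a u)^-1%g); rewrite mulgV.
apply: chi_inj => [|j g lt_j lt_g]; first by rewrite groupM ?groupV.
apply: (addIr (chi (a u) j g)); rewrite -chiM ?groupM ?groupV //.
by rewrite mulgKV add0r aE // uE.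
Qed.

(** The inverse of s is lifted, as in [kummer_radical_data], so that conjugation by t acts on [chi]
    by the rule of [jcoord]. *)
Definition lifts t := forall e, t (i e) = i (s^-1%g e).

Lemma lifts_inv t e : lifts t -> t^-1%g (i e) = i (s e).
Proof.
move=> tE; have : t (i (s e)) = i e by rewrite tE -galM_full mulgV gal_id.
by move=> <-; rewrite -galM_full mulgV gal_id.
Qed.

Lemma lifts_mulN t x : lifts t -> x \in N -> lifts (t * x)%g.
Proof. by move=> tE /extNP xE e; rewrite galM_full tE xE. Qed.

Lemma liftsX t c e : lifts t -> (t ^+ c)%g (i e) = i ((s^-1 ^+ c)%g e).
Proof. by move=> tE; elim: c => [|c IHc]; rewrite ?gal_id // !galXS IHc tE. Qed.

Lemma lifts_conj t x : lifts t -> x \in N ->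
  [/\ (x ^ t)%g \in N,
      forall j, (j < size l)%N -> chi (x ^ t)%g j 0%N = chi x j 0%N
    & forall j g, (j < size l)%N -> (g.+1 < nth 0%N l j)%N ->
        chi (x ^ t)%g j g.+1 = chi x j g.+1 + chi x j g].
Proof.
move=> tE Nx; have xE := elimT (extNP x) Nx.
have xtE e : (x ^ t)%g e = t (x (t^-1%g e)) by rewrite conjgE !galM_full.
have tK e : t (t^-1%g e) = e by rewrite -galM_full mulVg gal_id.
split.
- by apply/extNP=> e; rewrite xtE lifts_inv // xE tE -galM_full mulgV gal_id.
- move=> j lt_j; have /andP[lt_0 _] := l_bnd (mem_nth 0%N lt_j).
  apply: chi_eq => //; rewrite xtE.
  have [u nzu su] := radical_fix data_b lt_j.
  have [||d te] := pth_root_eq p_pr prim_z (u := t^-1%g (bL j 0%N)) (v := bL j 0%N * i u).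
  + by rewrite mulf_neq0 ?bL_neq0 ?ext_eq0.
  + by rewrite -rmorphXn bLp // [LHS]lifts_inv // su exprMn bLp // rmorphM rmorphXn.
  have -> : x (t^-1%g (bL j 0%N)) = zL ^+ chi x j 0%N * t^-1%g (bL j 0%N).
    by rewrite te !rmorphM /= gal_zA xE chiE // -!mulrA mulrCA.
  by rewrite rmorphM /= gal_zA tK.
move=> j g lt_j lt_g; apply: chi_eq => //; rewrite xtE.
have [u nzu su] := radical_next data_b lt_j lt_g.
have lt_g' := ltnW lt_g.
have [||d te] := pth_root_eq p_pr prim_z (u := t^-1%g (bL j g.+1))
  (v := bL j g.+1 * bL j g * i u).
+ by rewrite !mulf_neq0 ?bL_neq0 ?ext_eq0.
+ by rewrite -rmorphXn bLp // [LHS]lifts_inv // su !exprMn !bLp // !rmorphM rmorphXn.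
have -> : x (t^-1%g (bL j g.+1)) = zL ^+ (chi x j g.+1 + chi x j g)%R * t^-1%g (bL j g.+1).
  rewrite zAD // te !rmorphM /= gal_zA xE !chiE //.
  by rewrite [X in X * i u]mulrACA -[X in zL ^+ d * X = _]mulrA mulrCA.
by move: (_ + _)%R => c; rewrite rmorphM /= gal_zA tK.
Qed.

Lemma lifts_pow_mem t : lifts t -> (t ^+ (p ^ n))%g \in N.
Proof.
by move=> tE; apply/extNP=> e; rewrite liftsX // expgVn -ord_s expg_order invg1 gal_id.
Qed.

(** t commutes with its power, so conjugation leaves the coordinate at g.+1 unchanged, while
    [lifts_conj] adds the coordinate at g to it. *)
Lemma lifts_pow_mid t j g : lifts t -> (j < size l)%N -> (g.+1 < nth 0%N l j)%N ->
  chi (t ^+ (p ^ n))%g j g = 0.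
Proof.
move=> tE lt_j lt_g; set x := (t ^+ (p ^ n))%g.
have [_ _ xt] := lifts_conj tE (lifts_pow_mem tE).
have := xt j g lt_j lt_g; have -> : (x ^ t = x)%g by rewrite /x conjXg conjgE mulKg.
by move/eqP; rewrite -[X in X == _]addr0 (inj_eq (addrI _)) eq_sym => /eqP.
Qed.

(** In a block shorter than p^n, the norm of the top is trivial modulo p-th powers, hence c^p with c
    fixed by s. The norm C of the p-th root is then a root of unity times c, so it is fixed by T,
    and telescoping makes T^(p^n) fix the root. *)
Lemma lifts_pow_top t j : lifts t -> (j < size l)%N -> (nth 0%N l j < p ^ n)%N ->
  chi (t ^+ (p ^ n))%g j (nth 0%N l j).-1 = 0.
Proof.
move=> tE lt_j lt_lj; have /andP[lj_gt0 _] := l_bnd (mem_nth 0%N lt_j).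
set r := nth 0%N l j in lt_lj lj_gt0 *; have lt_r : (r.-1 < r)%N by rewrite prednK.
pose x := b j r.-1; have nzx : x != 0 by apply: nzb.
have Nx1 : eq_pow p (nrm s (p ^ n) x) 1.
  apply: eq_pow_trans (eq_pow_sym (diff_expp_pred p_pr s n nzx)) _.
  apply: (@diff_le p F K p_pr s r) => //.
    by rewrite -ltnS prednK // expn_gt0 p_gt0.
  rewrite -(prednK lj_gt0) -add1n.
  apply: eq_pow_trans (diff_add p_pr s _ _ nzx) _.
  have Dx : eq_pow p (diff p s r.-1 x) (b j 0%N).
    have := diff_radical_iter p_pr data_b (j := j) (g := 0%N) (i := r.-1) lt_j.
    by rewrite add0n; apply.
  apply: eq_pow_trans (diff_eq_pow s 1 Dx) _.
  exact: (diff_radical p_pr data_b lt_j lj_gt0).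
have [c sc Nx] := radical_norm data_b lt_j Nx1.
pose T := (t^-1)%g; pose C := nrm T (p ^ n) (bL j r.-1).
have TX (y : nat) e : (T ^+ y)%g (i e) = i ((s ^+ y)%g e).
  by elim: y => [|y IHy]; rewrite ?gal_id // !galXS IHy lifts_inv.
have Cp : C ^+ p = i c ^+ p.
  rewrite -nrmX bLp // -rmorphXn -Nx /nrm rmorph_prod; apply: eq_bigr => y _.
  exact: TX.
have nzc : i c != 0.
  rewrite ext_eq0; apply: contraTneq (nrm_neq0 s (p ^ n) nzx) => c0.
  by rewrite Nx c0 expr0n gtn_eqF //= eqxx.
have [d CE] := pth_root_eq p_pr prim_z nzc Cp.
have TC : T C = C by rewrite CE rmorphM /= gal_zA lifts_inv // sc.
have nzB := bL_neq0 lt_j lt_r.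
have Tq : (T ^+ (p ^ n))%g (bL j r.-1) = bL j r.-1.
  apply: (mulfI (nrm_neq0 T (p ^ n) nzB)); rewrite -nrm_tele -/C.
  by rewrite TC.
apply: chi_eq => //; rewrite expr0 mul1r -{1}Tq -galM_full.
by rewrite /T expgVn mulVg gal_id.
Qed.

(* t0 ^+ (p ^ n) has coordinates only on the tops of blocks of full length    *)
(* p ^ n, and these are cancelled by the top coordinate of the norm of u1.    *)
Lemma radical_split_gal : exists t a, split_gal A t a.
Proof.
have [a [aN aE aP]] := kummer_iso; have [_ kI kS kZ kA] := jk.
have a_inj : injective a.
  by move=> u v uv; apply: coord_inj => j g lt_j lt_g; rewrite -!aE // uv.
have a_eq u x : x \in N ->
    (forall j g, (j < size l)%N -> (g < nth 0%N l j)%N -> chi x j g = k u j g) -> x = a u.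
  move=> Nx xE; have [v xv] := aP x Nx; rewrite xv; congr a.
  by apply: coord_inj => j g lt_j lt_g; rewrite -xE // xv aE.
have aD u v : a (u + v) = (a u * a v)%g.
  by apply/esym/a_eq => [|j g lt_j lt_g]; rewrite ?groupM // chiM // !aE // kD.
have a0 : a 0 = 1%g by apply: (mulgI (a 0)); rewrite -aD addr0 mulg1.
have a_act t u : lifts t -> (a u ^ t)%g = a (u *m A sigma).
  move=> tE; have [aut at0 atS] := lifts_conj tE (aN u).
  apply: a_eq => // j [|g] lt_j lt_g; first by rewrite at0 // kZ // aE.
  by rewrite atS // kA // !aE // ltnW.
have pn_gt0 : (0 < p ^ n)%N by rewrite expn_gt0 p_gt0.
have [t0 t0E] := ext_lift.
have [v0 v0E] := aP _ (lifts_pow_mem t0E).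
have [u1 u1E] := kS (fun j g => if g == 0%N then - k v0 j (nth 0%N l j).-1 else 0).
(* S c is u1 times 1 + A sigma + ... + (A sigma)^(c-1), the correction in the c-th power of t0 * a
   u1. As u1 has only bottom coordinates, those of S c are binomial multiples, and at c = p^n the
   top of a full block receives exactly the bottom coordinate of u1. *)
pose S c := iter c (fun S => S *m A sigma + u1) 0.
have SE c j h : (j < size l)%N -> (h < nth 0%N l j)%N ->
    k (S c) j h = k u1 j 0%N *+ 'C(c, h.+1).
  move=> lt_j; elim: c h => [|c IHc] h lt_h; first by rewrite coord0 bin0n mulr0n.
  rewrite /= kD binS mulrnDr; case: h lt_h => [|h] lt_h.
    by rewrite kZ // IHc // bin0 mulr1n.
  have -> : k u1 j h.+1 = 0 by rewrite u1E.
  by rewrite addr0 kA // !IHc // ltnW.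
pose t := (t0 * a u1)%g; have tE : lifts t by apply: lifts_mulN.
have tX c : (t ^+ c = t0 ^+ c * a (S c))%g.
  elim: c => [|c IHc]; first by rewrite /= a0 mulg1.
  rewrite expgSr IHc /= aD -(a_act t0) // expgSr /t conjgE !mulgA.
  by rewrite -[(_ * t0 * t0^-1)%g]mulgA mulgV mulg1.
have tq : (t ^+ (p ^ n) = 1)%g.
  apply: chi_inj (lifts_pow_mem tE) _ => j g lt_j lt_g.
  have [lt_g1 | ge_g1] := ltnP g.+1 (nth 0%N l j); first exact: lifts_pow_mid.
  have gE : g = (nth 0%N l j).-1.
    by apply/eqP; rewrite -eqSS prednK ?(leq_ltn_trans _ lt_g) // eqn_leq lt_g ge_g1.
  have /andP[lj_gt0] := l_bnd (mem_nth 0%N lt_j).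
  rewrite leq_eqVlt => /orP[/eqP ljq | lt_lj]; last by rewrite gE; apply: lifts_pow_top.
  have gS : g.+1 = (p ^ n)%N by rewrite gE prednK.
  rewrite tX v0E -aD aE // kD SE // gS binn mulr1n u1E // eqxx -gE.
  exact: subrr.
have t_tri c u : (t ^+ c)%g = a u -> (#[sigma]%g %| c)%N.
  move=> tcu; rewrite ord_sigma -ord_s -orderV order_dvdn; apply/eqP/eqP/gal_eqP => e _.
  apply: ext_inj; rewrite -(liftsX c e tE) tcu gal_id.
  exact: (elimT (extNP _)).
exists t, a; split=> //.
- by move=> u; apply: a_act.
- move=> x; have [s' s'E] := restrict_gal (ext_normal x).
  have fixed1 : fixedField <[s]>%g = 1%VS.
    apply/eqP; rewrite eqEsubv sub1v andbT; apply/subvP=> e /mem_fixedFieldP[_ se].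
    exact/fix_s/se/cycle_id.
  have /cycleP[c s'c] : s' \in <[s]>%g.
    by rewrite -[<[s]>%g](gal_fixedField <[s]>%G) /= fixed1 mem_gal_full.
  have Ntx : (t ^+ c * x)%g \in N.
    apply/extNP=> e; rewrite galM_full liftsX // -s'E s'c -galM_full expgVn mulVg.
    by rewrite gal_id.
  have [u tcx] := aP _ Ntx.
  have [c' tc'] : exists c', ((t ^+ c)^-1 = t ^+ c')%g.
    by apply/cycleP; rewrite groupV mem_cycle.
  by exists c', u; rewrite -tc' -tcx mulKg.
- apply/eqP; rewrite eqn_dvd {1}ord_sigma order_dvdn tq eqxx /=.
  by apply: (t_tri _ 0); rewrite expg_order a0.
Qed.

Lemma ext_galois1 : galois 1 {:L}.
Proof.
apply/galois_fixedField/eqP; rewrite eqEsubv andbC galois_connection_subv ?sub1v //=.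
apply/subvP=> e /mem_fixedFieldP[_ fe].
have : e \in E.
  rewrite -(galois_fixedField ext_galois); apply/fixedFieldP; rewrite ?memvf // => x _.
  exact/fe/mem_gal_full.
case/ext_memP=> e' eE; have [t tE] := ext_lift.
have : s e' = e'.
  apply: ext_inj; rewrite -(lifts_inv e' tE) -eE.
  exact/fe/mem_gal_full.
by move/fix_s/vlineP=> [c e'E]; rewrite eE e'E rmorph_alg; apply/vlineP; exists c.
Qed.

End RadicalExtension.

(** * Descent of the root of unity, and assembly *)

Lemma radical_realizes (p n : nat) (F : fieldType) (z : F)
    (K : splittingFieldType F) (s : gal_of {:K}) (l : seq nat) b
    (gT : finGroupType) (sigma : gT) (m : nat)
    (A : mx_representation 'F_p <[sigma]>%G m) k :
    prime p -> p.-primitive_root z -> #[s]%g = (p ^ n)%N ->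
    (forall e, s e = e -> e \in 1%VS) -> radical_data p n s l b ->
    {in l, forall i, 0 < i <= p ^ n}%N -> #[sigma]%g = (p ^ n)%N ->
    jcoord (A sigma) l k ->
  realizes F (modsdprod A).
Proof.
move=> p_pr prim_z ord_s fix_s data_b l_bnd ord_sigma jk.
have p_gt0 := prime_gt0 p_pr.
have [L [i [ys [ysP ys_gen]]]] := adjoin_roots (radical_poly_neq0 n s l b p_gt0)
  (radical_poly_over1 l b p_gt0 ord_s fix_s).
have [bL bLp] : exists bL : nat -> nat -> L, forall j g, (j < size l)%N ->
    (g < nth 0%N l j)%N -> bL j g ^+ p = i (b j g).
  have bex j g : exists y : L,
      (j < size l)%N && (g < nth 0%N l j)%N ==> (y ^+ p == i (b j g)).
    case: (boolP (_ && _)) => [/andP[lt_j lt_g] | _]; last by exists 0.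
    exact: (radical_exists p_pr ysP).
  exists (fun j g => xchoose (bex j g)) => j g lt_j lt_g.
  by apply/eqP/(implyP (xchooseP (bex j g))); apply/andP.
have [t [a split_a]] := radical_split_gal p_pr prim_z ord_s fix_s data_b l_bnd ysP ys_gen
  bLp ord_sigma jk.
apply: (split_gal_realizes _ split_a).
exact (ext_galois1 p_pr prim_z fix_s data_b ysP ys_gen).
Qed.

(** If s z = z^c, then s^(p^n) = 1 raises z to the power c^(p^n), which is c modulo p by Fermat; so
    z = z^c = s z. *)
Lemma prim_root_base (p n : nat) (F : fieldType) (K : splittingFieldType F)
    (s : gal_of {:K}) : prime p -> galois 1 {:K} -> ('Gal({:K} / 1) = <[s]>)%g ->
    #[s]%g = (p ^ n)%N -> (exists z : K, p.-primitive_root z) ->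
  exists z : F, p.-primitive_root z.
Proof.
move=> p_pr galK galE ord_s [z prim_z].
have [c _ sz] := aut_prim_rootP s prim_z.
have sX j : (s ^+ j)%g z = z ^+ (c ^ j).
  by elim: j => [|j IHj]; rewrite ?gal_id // galXS IHj rmorphXn /= sz -exprM expnS.
have fermat j : c ^ (p ^ j) = c %[mod p].
  elim: j => // j IHj; rewrite expnSr expnM -modnXm IHj modnXm.
  by have := fermat_little c p_pr.
have fix_z : s z = z.
  have := sX (p ^ n)%N; rewrite -ord_s expg_order gal_id ord_s sz => {2}->.
  by apply/eqP; rewrite (eq_prim_root_expr prim_z) fermat.
have : z \in 1%VS.
  rewrite -(galois_fixedField galK) galE; apply/fixedFieldP; rewrite ?memvf //.
  by move=> _ /cycleP[j ->]; apply: gal_fixX.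
case/vlineP=> z0 zE; exists z0.
by rewrite -(fmorph_primitive_root (in_alg K)) /= -zE.
Qed.

Theorem theorem1p2 (p n : nat) (F : fieldType) (K : splittingFieldType F)
    (sigma : gal_of {:K}) (d : nat -> nat) (m : nat)
    (A : mx_representation 'F_p <[sigma]>%G m)
    (p_prime : prime p) (n_ge1 : (1 <= n)%N)
    (galKF : galois 1 {:K})
    (GalKF : ('Gal({:K} / 1) = <[sigma]>)%g)
    (ord_sigma : #[sigma]%g = (p ^ n)%N)
    (mu_p : exists z : K, p.-primitive_root z)
    (A_decomp : mx_rsim A (cyc_sum p sigma (p ^ n) d id)) :
  realizes F (modsdprod A) ->
  realizes F (modsdprod (ceil_mod p sigma (p ^ n) d)).
Proof.
have [z prim_z] := prim_root_base p_prime galKF GalKF ord_sigma mu_p.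
pose l := blocks (p ^ n) d id.
pose ceil i := (p ^ up_log p i)%N.
have ceilP i : (0 < i <= p ^ n)%N -> (0 < ceil i <= p ^ n)%N.
  move=> i_bnd; have /andP[le_i ->] := ceil_bnd p_prime i_bnd.
  by rewrite andbT expn_gt0 prime_gt0.
have l_bnd : {in l, forall i, 0 < i <= p ^ n}%N.
  move=> i /flatten_mapP[j]; rewrite mem_index_iota ltnS => j_bnd.
  by case/nseqP=> -> _.
have l'E : map ceil l = blocks (p ^ n) d ceil.
  rewrite /l /blocks map_flatten -map_comp; congr flatten; apply: eq_map => i /=.
  exact: map_nseq.
have [k jk] : exists k, jcoord (A sigma) l k.
  case: A_decomp => B mE freeB AB; apply: (jcoord_sim mE freeB (AB _ (cycle_id _))).
  exact: (jcoord_cyc_sum p_prime ord_sigma).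
have [k' jk'] : exists k, jcoord (ceil_mod p sigma (p ^ n) d sigma) (map ceil l) k.
  by rewrite l'E; apply: (jcoord_cyc_sum p_prime ord_sigma).
case/realizes_split_gal=> L [t [a [galL split_a]]].
have [K1 [s [b [ord_s fix_s data_b]]]] :=
  kummer_radical_data p_prime prim_z ord_sigma galL split_a jk.
have [b' data_b'] := radical_lift p_prime ord_s (prim_zA K1 prim_z)
  (rmorph_alg s z) data_b l_bnd.
apply: (radical_realizes p_prime prim_z ord_s fix_s data_b' _ ord_sigma jk').
by move=> _ /mapP[i /l_bnd/ceilP ? ->].
Qed.
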